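(* Let $(X,\mu)$ be a standard atomless probability space and let $T\in\mathrm{Aut}(X,[\mu])$ be aperiodic. Then the commensurating full group $[T]_{\mathrm{com}}$ is a Polish group.
   Context: $\mathrm{Aut}(X,[\mu])$ is the group of measurable bijections $T:X\to X$ such that $T_*\mu$ and $\mu$ have the same null sets, two such maps being identified if they agree almost everywhere. $T$ is aperiodic if almost every $T$-orbit is infinite. Let $T\in\mathrm{Aut}(X,[\mu])$ be aperiodic. The full group $[T]$ is the group of $S\in\mathrm{Aut}(X,[\mu])$ such that for a.e. $x$, $S(x)=T^{c_S(x)}(x)$ for some integer $c_S(x)$; the a.e. uniquely defined measurable map $c_S:X\to\mathbb Z$ is the cocycle of $S$. Let $\mathrm{Sym}(\mathbb Z,\mathbb N)$ be the group of permutations $\sigma$ of $\mathbb Z$ with $|\sigma(\mathbb N)\triangle\mathbb N|<\infty$, with the group topology for which a basis of neighborhoods of the identity is given by the pointwise stabilizers of finite subsets of $\mathrm{Comm}(\mathbb N)=\{M\subset\mathbb Z: |M\triangle\mathbb N|<\infty\}$. For $S\in[T]$, $x\in X$, define the permutation $\Phi(S)(x)$ of $\mathbb Z$ by $\Phi(S)(x)(n)=n+c_S(T^n(x))$. The commensurating full group is $$[T]_{\mathrm{com}}=\{S\in[T]:\ \Phi(S)(x)\in\mathrm{Sym}(\mathbb Z,\mathbb N)\text{ for a.e. }x\},$$ endowed with the topology pulled back by $\Phi$ from $\mathrm L^0(X,\mu,\mathrm{Sym}(\mathbb Z,\mathbb N))$, the group (under pointwise multiplication) of measurable maps $X\to\mathrm{Sym}(\mathbb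 Z,\mathbb N)$ modulo a.e. equality, with the topology of convergence in measure: for a metric $d$ compatible with the topology of $\mathrm{Sym}(\mathbb Z,\mathbb N)$, a basis of neighborhoods of $f$ is given by the sets $\{g:\mu\{x: d(f(x),g(x))<\epsilon\}>1-\epsilon\}$, $\epsilon>0$. A Polish group is a topological group whose underlying space is separable and completely metrizable. *)

(* Defs.v *)
From HB Require Import structures.
From mathcomp Require Import all_boot all_order all_algebra.
From mathcomp Require Import all_classical all_reals all_analysis.

Set Implicit Arguments.
Unset Strict Implicit.
Unset Printing Implicit Defensive.

Import Order.TTheory GRing.Theory Num.Theory.
Import numFieldNormedType.Exports.

Local Open Scope classical_set_scope.
Local Open Scope ring_scope.

Section Metrics.
Variables (R : realType) (T : Type).

Definition is_metric (d : T -> T -> R) : Prop :=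
  [/\ forall x y, 0 <= d x y,
      forall x y, d x y = 0 <-> x = y,
      forall x y, d x y = d y x &
      forall x y z, d x z <= d x y + d y z].

Definition metric_open (d : T -> T -> R) : set_system T :=
  [set U | forall x, U x -> exists2 e, 0 < e & [set y | d x y < e] `<=` U].

Definition metric_complete (d : T -> T -> R) : Prop :=
  forall u : nat -> T,
    (forall e, 0 < e -> exists N, forall m n,
       (N <= m)%N -> (N <= n)%N -> d (u m) (u n) < e) ->
    exists l, forall e, 0 < e -> exists N, forall n, (N <= n)%N -> d (u n) l < e.

Definition metric_separable (d : T -> T -> R) : Prop :=
  exists2 D : set T, countable D &
    forall x e, 0 < e -> exists2 y, D y & d x y < e.

End Metrics.

Definition compatible_metric (R : realType) (T : topologicalType)
    (d : T -> T -> R) : Prop :=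
  is_metric d /\ @open T = metric_open d.

Definition separable_space (T : topologicalType) : Prop :=
  exists2 D : set T, countable D & dense D.

Definition completely_metrizable (R : realType) (T : topologicalType) : Prop :=
  exists2 d : T -> T -> R, compatible_metric d & metric_complete d.

Record polish_group (R : realType) (G : topologicalType)
    (mul : G -> G -> G) (one : G) (inv : G -> G) : Prop := PolishGroup {
  polish_group_mulA : associative mul;
  polish_group_mul1 : left_id one mul;
  polish_group_mulV : left_inverse one inv mul;
  polish_group_mul_continuous : continuous (fun p : G * G => mul p.1 p.2);
  polish_group_inv_continuous : continuous inv;
  polish_group_separable : separable_space G;
  polish_group_completely_metrizable : completely_metrizable R G }.

(* Standard Borel space: the sigma-algebra is the Borel sigma-algebra of some
   separable complete metric. *)
Definition standard_borel (R : realType) (disp : measure_display)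
    (X : measurableType disp) : Prop :=
  exists rho : X -> X -> R,
    [/\ is_metric rho, metric_complete rho, metric_separable rho &
        @measurable disp X = <<s metric_open rho >>].

Definition atomless (R : realType) (disp : measure_display)
    (X : measurableType disp) (mu : set X -> \bar R) : Prop :=
  forall A, measurable A -> (0 < mu A)%E ->
    exists B, [/\ measurable B, B `<=` A, (0 < mu B)%E & (mu B < mu A)%E].

Section Inverse.
Variable (T : Type).

Definition bij_inv (f : T -> T) : T -> T := 'pinv_(fun x => x) [set: T] f.

Lemma bij_invK (f : T -> T) : bijective f -> cancel f (bij_inv f).
Proof.
by move=> /bij_inj fI x; apply: pinvKV; rewrite ?inE// => ? ? _ _ /fI.
Qed.

Lemma bij_invVK (f : T -> T) : bijective f -> cancel (bij_inv f) f.
Proof. by move=> fb x; case: (fb) => g fK gK; rewrite -(gK x) bij_invK. Qed.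

(* The iterate T^n of a bijection, for n in Z. *)
Definition iterz (f : T -> T) (n : int) : T -> T :=
  match n with Posz k => iter k f | Negz k => iter k.+1 (bij_inv f) end.

End Inverse.

Section SymZN.

Definition natZ : set int := [set n | 0 <= n].

Definition CommN : set (set int) := [set M | finite_set (M `+` natZ)].

Definition commensurating (s : int -> int) : Prop :=
  bijective s /\ CommN (s @` natZ).

Record symZN := SymZN {
  symZN_fun :> int -> int;
  symZN_subproof : `[< commensurating symZN_fun >] }.

HB.instance Definition _ := [isSub for symZN_fun].
HB.instance Definition _ := [Choice of symZN by <:].

Lemma symZNP (s : symZN) : commensurating s.
Proof. exact/asboolP/(valP s). Qed.

Lemma symZN_image_CommN (s : symZN) M : CommN M -> CommN (s @` M).
Proof.
move=> cM; have [sb sN] := symZNP s; have sI := bij_inj sb.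
apply: (@sub_finite_set _ _ ((s @` (M `+` natZ)) `|` ((s @` natZ) `+` natZ))).
  rewrite !setY_def => x /= [[[m Mm <-] nN]|[Nx nM]].
    have [mN|mN] := pselect (natZ m).
      by right; left; split => //; exists m.
    by left; exists m => //; left.
  case: (sb) => g gK sK; rewrite -(sK x) in nM Nx *.
  have [mN|mN] := pselect (natZ (g x)).
    by left; exists (g x) => //; right; split => // Mg; apply: nM; exists (g x).
  by right; right; split => // -[y Ny /sI yg]; apply: mN; rewrite -yg.
by rewrite finite_setU; split => //; exact: finite_image.
Qed.

Lemma commensurating_id : commensurating id.
Proof. by split; [exists id|rewrite image_id /CommN /= setYK]. Qed.

Lemma commensurating_comp (s t : symZN) : commensurating (s \o t).
Proof.
split; first by apply: bij_comp; [exact: (symZNP s).1|exact: (symZNP t).1].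
by rewrite -image_comp; apply: symZN_image_CommN; exact: (symZNP t).2.
Qed.

Lemma commensurating_inv (s : symZN) : commensurating (bij_inv s).
Proof.
have [sb sN] := symZNP s; have sK := bij_invK sb; have Ks := bij_invVK sb.
split; first by exists s.
apply: (@sub_finite_set _ _ (bij_inv s @` ((s @` natZ) `+` natZ))).
  rewrite !setY_def => x /= [[[m Nm <-] nN]|[Nx nM]].
    exists m => //; right; split=> // -[y Ny ym]; apply: nN.
    by rewrite -ym sK.
  exists (s x); last exact: sK.
  by left; split; [exists x|move=> Nsx; apply: nM; exists (s x)].
exact: finite_image.
Qed.

Definition symZN_one : symZN := SymZN (asboolT commensurating_id).
Definition symZN_mul (s t : symZN) : symZN :=
  SymZN (asboolT (commensurating_comp s t)).
Definition symZN_inv (s : symZN) : symZN :=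
  SymZN (asboolT (commensurating_inv s)).

Lemma symZN_mulA : associative symZN_mul.
Proof. by move=> s t u; apply: val_inj. Qed.

Lemma symZN_mul1 : left_id symZN_one symZN_mul.
Proof. by move=> s; apply: val_inj. Qed.

Lemma symZN_mulr1 : right_id symZN_one symZN_mul.
Proof. by move=> s; apply: val_inj. Qed.

Lemma symZN_mulV : left_inverse symZN_one symZN_inv symZN_mul.
Proof.
by move=> s; apply: val_inj; apply/funext => n /=; rewrite bij_invK//; case: (symZNP s).
Qed.

Lemma symZN_mulrV : right_inverse symZN_one symZN_inv symZN_mul.
Proof.
by move=> s; apply: val_inj; apply/funext => n /=; rewrite bij_invVK//; case: (symZNP s).
Qed.

HB.instance Definition _ := isPointed.Build symZN symZN_one.
HB.instance Definition _ := isGroup.Build symZN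
  symZN_mulA symZN_mul1 symZN_mulr1 symZN_mulV symZN_mulrV.

Definition pointwise_stabilizer (F : set (set int)) : set symZN :=
  [set s : symZN | forall M, F M -> s @` M = M].

(* The group topology for which the pointwise stabilizers of the finite
   subsets F of CommN form a basis of neighborhoods of 1: the left translates
   s * Stab(F) form a basis of neighborhoods of s. *)
Definition symZN_open : set_system symZN :=
  [set U | forall s, U s -> exists F : set (set int),
     [/\ finite_set F, F `<=` CommN &
         [set (s * t)%g | t in pointwise_stabilizer F] `<=` U]].

Let symZN_openT : symZN_open setT.
Proof. by move=> s _; exists set0; split. Qed.

Let symZN_openI : setI_closed symZN_open.
Proof.
move=> U V oU oV s [/oU[F [fF cF FU]] /oV[F' [fF' cF' FV]]].
exists (F `|` F'); split; first by rewrite finite_setU.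
  by move=> M [/cF|/cF'].
move=> _ [t st <-]; split.
- by apply: FU; exists t => // M FM; apply: st; left.
- by apply: FV; exists t => // M FM; apply: st; right.
Qed.

Let symZN_open_bigU (I : Type) (f : I -> set symZN) :
  (forall i, symZN_open (f i)) -> symZN_open (\bigcup_i f i).
Proof.
move=> of_ s [i _ /of_[F [fF cF FU]]]; exists F; split=> //.
by move=> t /FU ft; exists i.
Qed.

HB.instance Definition _ := isOpenTopological.Build symZN
  symZN_openT symZN_openI symZN_open_bigU.

Lemma symZN_openE : @open symZN = symZN_open. Proof. by []. Qed.

End SymZN.

Section SymZNBase.

Definition CommN_of (F : seq int) : set int := [set` F] `+` natZ.

Lemma CommN_ofP M : CommN M <-> exists F, M = CommN_of F.
Proof.
split=> [/finite_seqP[F MF]|[F ->]].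
  by exists F; rewrite /CommN_of -MF -setYA setYK setY0.
by rewrite /CommN /= /CommN_of -setYA setYK setY0; exact: finite_seq.
Qed.

Definition symZN_base (l : seq (seq int * seq int)) : set symZN :=
  [set s : symZN | forall p, p \in l -> s @` CommN_of p.1 = CommN_of p.2].

Lemma symZN_base_open l : open (symZN_base l).
Proof.
move=> s sl; exists [set CommN_of p.1 | p in [set` l]]; split.
- by apply: finite_image; exact: finite_seq.
- by move=> _ [p _ <-]; apply/CommN_ofP; exists p.1.
- move=> _ [t st <-] p pl; rewrite -(sl _ pl) -[in RHS](st (CommN_of p.1)).
    by rewrite image_comp.
  by exists p.
Qed.

Lemma symZN_baseP (U : set symZN) (s : symZN) : open U -> U s ->
  exists2 l, symZN_base l s & symZN_base l `<=` U.
Proof.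
move=> oU /oU[F [/finite_seqP[r ->] cF FU]].
have /choice[a aP] (M : set int) : exists A, CommN M -> M = CommN_of A.
  have [/CommN_ofP[A ->]|nM] := pselect (CommN M); first by exists A.
  by exists [::] => /nM.
exists [seq (a M, a (s @` M)) | M <- r].
  move=> _ /mapP[M Mr ->] /=.
  by rewrite -!aP//; [apply: symZN_image_CommN; exact: cF|exact: cF].
move=> t tl; apply: FU; exists (s^-1 * t)%g; last by rewrite mulgA mulgV mul1g.
move=> M /= Mr.
have cM : CommN M by exact: cF.
have := tl (a M, a (s @` M)).
rewrite map_f//= => /(_ isT).
rewrite -(aP _ cM) -(aP _ (symZN_image_CommN _ cM)) => tM. rewrite -[LHS](image_comp t (bij_inv s)) tM image_comp -[RHS]image_id.
by apply: eq_imagel => n _ /=; rewrite bij_invK//; case: (symZNP s).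
Qed.

End SymZNBase.

Record symZN_metric (R : realType) := SymZNMetric {
  symZN_dist :> symZN -> symZN -> R;
  symZN_metric_compatible : compatible_metric symZN_dist }.

Section SymZNMetricExists.
Variable R : realType.

Let agree (s t : symZN) (n : nat) :=
  forall F : seq int, (pickle F < n)%N -> s @` CommN_of F = t @` CommN_of F.
Let gap (s t : symZN) : set R := [set n.+1%:R^-1 | n in agree s t].
Let dist (s t : symZN) : R := inf (gap s t).

Let gap_lb s t : lbound (gap s t) 0.
Proof. by move=> _ [n _ <-]; rewrite invr_ge0. Qed.

Let gap_inf s t : has_inf (gap s t).
Proof.
by split; [exists 1%:R^-1; exists 0%N|exists 0; exact: gap_lb].
Qed.

Let dist_le s t n : agree s t n -> dist s t <= n.+1%:R^-1.
Proof. by move=> st; apply: ge_inf; [exists 0; exact: gap_lb|exists n]. Qed.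

Let dist_lt s t e : dist s t < e -> exists2 n, agree s t n & n.+1%:R^-1 < e.
Proof. by move=> /(inf_lt (gap_inf s t).1)[_ [n st <-] ne]; exists n. Qed.

Let agreeW s t m n : (m <= n)%N -> agree s t n -> agree s t m.
Proof. by move=> mn st F /leq_trans/(_ mn)/st. Qed.

Let small (e : R) : 0 < e -> exists n, n.+1%:R^-1 < e.
Proof.
by move=> e0; have [n _ /(_ n (leqnn n))] := near_infty_natSinv_lt (PosNum e0); exists n.
Qed.

Let dist_lt_agree s t n : dist s t < n.+1%:R^-1 -> agree s t n.
Proof.
move=> /dist_lt[m st]; rewrite ltf_pV2 ?posrE// ltr_nat ltnS => /ltnW nm.
exact: agreeW st.
Qed.

Let dist_metric : is_metric dist.
Proof.
have dist0 s : dist s s = 0.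
  apply/eqP; rewrite eq_le lb_le_inf ?andbT; [|by case: (gap_inf s s)|exact: gap_lb].
  apply/ler_addgt0Pl => e e0; rewrite addr0; have [n /ltW ne] := small e0.
  by apply: le_trans ne; apply: dist_le.
split.
- by move=> s t; apply: lb_le_inf; [case: (gap_inf s t)|exact: gap_lb].
- move=> s t; split=> [st|->//].
  have {}st F : s @` CommN_of F = t @` CommN_of F.
    have : dist s t < (pickle F).+2%:R^-1 by rewrite st invr_gt0.
    by move=> /dist_lt_agree; apply.
  have {}st M : CommN M -> s @` M = t @` M by move=> /CommN_ofP[F ->].
  apply/val_inj/funext => n /=; have := symZNP s; have := symZNP t.
  move=> [/bij_inj tI _] [/bij_inj sI _].
  have cN : CommN natZ by rewrite /CommN /= setYK.
  have c1 : CommN (natZ `|` [set n]).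
    apply: (@sub_finite_set _ _ [set n]); last exact: finite_set1.
    rewrite setY_def => x /= [[[Nx|->//] nx]|[Nx nx]]; exfalso; apply: nx => //.
    by left.
  have c2 : CommN (natZ `\ n).
    apply: (@sub_finite_set _ _ [set n]); last exact: finite_set1.
    rewrite setY_def => x /= [[[Nx _] nx]|[Nx nx]]; first by [].
    by apply: contrapT => xn; apply: nx.
  have [m [Nm|->//] tm] : (t @` (natZ `|` [set n])) (s n).
    by rewrite -(st _ c1); exists n => //; right.
  have [//|mn] := eqVneq m n; first by move=> mn; rewrite -mn in tm *.
  have : (s @` (natZ `\ n)) (s n).
    by rewrite (st _ c2); exists m => //; split=> //; exact/eqP.
  by case=> k [_ kn] /sI.
- move=> s t; congr inf; apply/seteqP; split=> _ [n st <-]; exists n => // F /st//.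
- move=> s t u; apply/ler_addgt0Pl => e e0.
  have e20 : 0 < e / 2 by rewrite divr_gt0.
  have [n st ne] : exists2 n, agree s t n & n.+1%:R^-1 < dist s t + e / 2.
    by apply: dist_lt; rewrite ltrDl.
  have [m tu me] : exists2 n, agree t u n & n.+1%:R^-1 < dist t u + e / 2.
    by apply: dist_lt; rewrite ltrDl.
  have su : agree s u (minn n m).
    by move=> F; rewrite leq_min => /andP[/st -> /tu].
  apply: le_trans (dist_le su) _.
  have : (minn n m).+1%:R^-1 <= n.+1%:R^-1 + m.+1%:R^-1 :> R.
    by rewrite /minn; case: ifP => _; rewrite ?lerDl ?lerDr invr_ge0.
  move=> /le_trans; apply; rewrite [leRHS](_ : _ = dist s t + e / 2 + (dist t u + e / 2)).
    by rewrite lerD// ltW.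
  by rewrite addrACA -splitr addrC.
Qed.

Lemma symZN_metric_exists : inhabited (symZN_metric R).
Proof.
split; exists dist; split; first exact: dist_metric.
apply/seteqP; split=> U.
  move=> oU s Us; have [l sl lU] := symZN_baseP oU Us.
  pose n := \max_(p <- l) (pickle p.1).+1.
  exists n.+1%:R^-1; first by rewrite invr_gt0.
  move=> t /= /dist_lt_agree st; apply: lU => p pl; rewrite -(sl _ pl).
  by apply/esym/st; rewrite /n (big_rem p)//= leq_max leqnn.
rewrite symZN_openE => mU s Us; have [e e0 eU] := mU s Us; have [n ne] := small e0.
exists [set CommN_of F | F in [set F | (pickle F < n)%N]]; split.
- apply: finite_image; apply: (finite_preimage (f := pickle)) (finite_II n).
  by move=> x y _ _; exact: (pcan_inj pickleK).
- by move=> _ [F _ <-]; apply/CommN_ofP; exists F.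
- move=> _ [t st <-]; apply: eU; apply: le_lt_trans ne; apply: dist_le => F Fn.
  by rewrite -[RHS](image_comp t s) (st (CommN_of F))//; exists F.
Qed.

End SymZNMetricExists.
Section SymZNMetricTheory.
Variables (R : realType) (d : symZN_metric R).

Lemma symZN_ball_open s e : open [set t | d s t < e].
Proof.
have [[d0 d00 dC dT] ->] := symZN_metric_compatible d.
move=> t /= ste; exists (e - d s t); first by rewrite subr_gt0.
by move=> u /=; rewrite ltrBrDl; exact: le_lt_trans.
Qed.

Definition borel_symZN := g_sigma_algebraType (@open symZN).
HB.instance Definition _ := Measurable.on borel_symZN.

Lemma measurable_symZN_dist (disp : measure_display) (X : measurableType disp)
    (f g : X -> borel_symZN) e :
  measurable_fun setT f -> measurable_fun setT g ->
  measurable [set x | d (f x) (g x) < e].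
Proof.
move=> mf mg; have [[d0 d00 dC dT] _] := symZN_metric_compatible d.
pose W (l : seq (seq int * seq int) * seq (seq int * seq int)) :=
  forall s t, symZN_base l.1 s -> symZN_base l.2 t -> d s t < e.
pose V l := if `[< W l >] then f @^-1` symZN_base l.1 `&` g @^-1` symZN_base l.2
            else set0.
rewrite (_ : [set x | _] = \bigcup_l V l).
  apply: countable_bigcupT_measurable => // l; rewrite /V; case: ifP => _ //.
  by apply: measurableI; rewrite -[X in measurable X]setTI; [apply: mf|apply: mg] => //;
     apply: sub_gen_smallest; exact: symZN_base_open.
apply/seteqP; split=> [x /= xe|x [l _]]; last first.
  by rewrite /V; case: ifP => // /asboolP Wl [fl gl]; exact: Wl.
pose r := (e - d (f x) (g x)) / 2.
have r0 : 0 < r by rewrite divr_gt0// subr_gt0.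
have base_ball (s : symZN) :
    exists2 l, symZN_base l s & symZN_base l `<=` [set t | d s t < r].
  apply: symZN_baseP; first exact: symZN_ball_open.
  by rewrite /= (_ : d s s = 0)//; apply/d00.
have [l1 fl1 l1B] := base_ball (f x); have [l2 gl2 l2B] := base_ball (g x).
exists (l1, l2) => //; rewrite /V ifT//; apply/asboolP => s t /l1B /= fs /l2B /= gt.
apply: le_lt_trans (dT _ (f x) _) _; rewrite dC.
apply: le_lt_trans (lerD (lexx _) (dT _ (g x) _)) _.
rewrite [ltRHS](_ : e = r + (d (f x) (g x) + r)).
  by rewrite ltrD// ltrD2l.
by rewrite addrCA -splitr addrC subrK.
Qed.

End SymZNMetricTheory.

Section L0.
Variables (R : realType) (disp : measure_display) (X : measurableType disp).
Variables (mu : {measure set X -> \bar R}).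

(* L^0(X, mu, Sym(Z, N)); the parameter d only serves to carry the metric that
   defines the topology of convergence in measure. *)
Definition L0 (d : symZN_metric R) : Type := {mfun_ mu, X >-> borel_symZN}.

Variable d : symZN_metric R.
HB.instance Definition _ := Choice.on (L0 d).

Definition L0_fun (f : L0 d) : X -> symZN := aqEqMfun_to_fun f.

Definition L0_one : L0 d := \pi_{mfun_ mu, X >-> borel_symZN}%qT (cst (1%g : symZN)).

Definition L0_ball (f : L0 d) (e : R) : set (L0 d) :=
  [set g : L0 d | ((1 - e)%:E < mu [set x | d (L0_fun f x) (L0_fun g x) < e]%R)%E].

Definition L0_open : set_system (L0 d) :=
  [set U | forall f, U f -> exists2 e, 0 < e & L0_ball f e `<=` U].

Let L0_ballW f e e' : e <= e' -> L0_ball f e `<=` L0_ball f e'.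
Proof.
move=> ee' g /= fg; apply: (@le_lt_trans _ _ (1 - e)%:E).
  by rewrite lee_fin lerD2l lerN2.
apply: (lt_le_trans fg); apply: le_measure; rewrite ?inE.
- by apply: measurable_symZN_dist; exact: measurable_funPT.
- by apply: measurable_symZN_dist; exact: measurable_funPT.
- by move=> x /= /lt_le_trans; apply.
Qed.

Let L0_openT : L0_open setT.
Proof. by move=> f _; exists 1. Qed.

Let L0_openI : setI_closed L0_open.
Proof.
move=> U V oU oV f [/oU[e e0 eU] /oV[e' e'0 eV]].
exists (Num.min e e'); first by rewrite lt_min e0.
move=> g fg; split.
- by apply: eU; apply: L0_ballW fg; rewrite ge_min lexx.
- by apply: eV; apply: L0_ballW fg; rewrite ge_min lexx orbT.
Qed.

Let L0_open_bigU (I : Type) (F : I -> set (L0 d)) :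
  (forall i, L0_open (F i)) -> L0_open (\bigcup_i F i).
Proof.
move=> oF f [i _ /oF[e e0 eF]]; exists e => //.
by move=> g /eF Fg; exists i.
Qed.

HB.instance Definition _ := isOpenTopological.Build (L0 d)
  L0_openT L0_openI L0_open_bigU.

Lemma L0_openE : @open (L0 d) = L0_open. Proof. by []. Qed.

End L0.

Section Aut.
Variables (R : realType) (disp : measure_display) (X : measurableType disp).
Variable mu : {measure set X -> \bar R}.

Definition nonsingular (f : X -> X) : Prop :=
  forall A, measurable A -> pushforward mu f A = 0%E <-> mu A = 0%E.

Definition is_aut (f : X -> X) : Prop :=
  [/\ bijective f, measurable_fun [set: X] f & nonsingular f].

Record preAut := PreAut {
  preAut_fun :> X -> X;
  preAut_subproof : `[< is_aut preAut_fun >] }.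

HB.instance Definition _ := [isSub for preAut_fun].
HB.instance Definition _ := [Choice of preAut by <:].

Lemma preAutP (f : preAut) : is_aut f.
Proof. exact/asboolP/(valP f). Qed.

Lemma is_aut_id : is_aut id.
Proof. by split=> //; exists id. Qed.

Lemma is_aut_comp (f g : preAut) : is_aut (f \o g).
Proof.
have [fb mf nf] := preAutP f; have [gb mg ng] := preAutP g.
split; [exact: bij_comp|exact: measurableT_comp|move=> A mA].
rewrite -nf// -[X in _ <-> X]ng; first by [].
by rewrite -[X in measurable X]setTI; exact: mf.
Qed.

Definition preAut_one : preAut := PreAut (asboolT is_aut_id).
Definition preAut_mul (f g : preAut) : preAut :=
  PreAut (asboolT (is_aut_comp f g)).

Definition aut_eq (f g : preAut) : bool := `[< {ae mu, forall x, f x = g x} >].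

Let aut_eq_refl : reflexive aut_eq.
Proof. by move=> f; apply/asboolP; exact: aeW. Qed.

Let aut_eq_sym : symmetric aut_eq.
Proof.
by move=> f g; apply/asboolP/asboolP; apply: filterS => x ->.
Qed.

Let aut_eq_trans : transitive aut_eq.
Proof.
move=> f g h /asboolP gf /asboolP fh; apply/asboolP.
by move: gf fh; apply: filterS2 => x ->.
Qed.

Canonical aut_eq_canonical :=
  EquivRel aut_eq aut_eq_refl aut_eq_sym aut_eq_trans.

Definition Aut : Type := {eq_quot aut_eq}%qT.
HB.instance Definition _ := Choice.on Aut.
HB.instance Definition _ := EqQuotient.on Aut.

Local Open Scope quotient_scope.

Definition Aut_of (f : preAut) : Aut := \pi_Aut f.

Lemma Aut_ofP (f g : preAut) :
  Aut_of f = Aut_of g <-> {ae mu, forall x, f x = g x}.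
Proof.
split=> [/eqP|fg]; first by rewrite eqmodE => /asboolP.
by apply/eqP; rewrite eqmodE; exact/asboolP.
Qed.

Lemma repr_Aut_of (f : preAut) : {ae mu, forall x, repr (Aut_of f) x = f x}.
Proof. by apply/Aut_ofP; rewrite /Aut_of reprK. Qed.

Definition Aut_one : Aut := Aut_of preAut_one.
Definition Aut_mul (S T : Aut) : Aut := Aut_of (preAut_mul (repr S) (repr T)).

Lemma Aut_of_comp (f g : preAut) :
  Aut_mul (Aut_of f) (Aut_of g) = Aut_of (preAut_mul f g).
Proof.
apply/Aut_ofP => /=.
have [A [mA A0 Af]] := repr_Aut_of f.
have gA : {ae mu, forall x, ~ A (g x)}.
  have [_ mg ng] := preAutP g.
  exists (g @^-1` A); split; [|exact/ng|by move=> x /= /contrapT].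
  by rewrite -[X in measurable X]setTI; exact: mg.
move: gA (repr_Aut_of g); apply: filterS2 => x nA -> .
by apply: contrapT => /Af.
Qed.

Lemma Aut_mulA : associative Aut_mul.
Proof.
move=> S T U; rewrite -(reprK S) -(reprK T) -(reprK U) -!/(Aut_of _) !Aut_of_comp.
by congr Aut_of; exact: val_inj.
Qed.

Lemma Aut_mul1 : left_id Aut_one Aut_mul.
Proof.
move=> S; rewrite -(reprK S) -!/(Aut_of _) Aut_of_comp.
by congr Aut_of; exact: val_inj.
Qed.

Lemma Aut_mulr1 : right_id Aut_one Aut_mul.
Proof.
move=> S; rewrite -(reprK S) -!/(Aut_of _) Aut_of_comp.
by congr Aut_of; exact: val_inj.
Qed.

HB.instance Definition _ := isMonoid.Build Aut Aut_mulA Aut_mul1 Aut_mulr1.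

Definition aperiodic (T : preAut) : Prop :=
  {ae mu, forall x, infinite_set (range (fun n => iterz T n x))}.

Definition full_group (T : preAut) : set Aut :=
  [set S : Aut | {ae mu, forall x, exists n, repr S x = iterz T n x}].

(* For aperiodic T the integer is unique for almost every x; the value on the
   remaining null set is irrelevant. *)
Definition cocycle (T S : preAut) (x : X) : int :=
  xget 0 [set n | S x = iterz T n x].

Definition Phi (T S : preAut) (x : X) : int -> int :=
  fun n => n + cocycle T S (iterz T n x).

Definition com_full_group (T : preAut) : set Aut :=
  [set S | full_group T S /\ {ae mu, forall x, commensurating (Phi T (repr S) x)}].

(* Phi as a map into L^0: the class of measurable maps X -> Sym(Z, N) that agree
   almost everywhere with Phi T (repr S).  There is at most one such class, and
   there is one when X is standard Borel, T is aperiodic and S belongs to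
   com_full_group T; L0_one is a dummy value. *)
Definition Phi_L0 (d : symZN_metric R) (T : preAut) (S : Aut) : L0 mu d :=
  xget (L0_one mu d)
    [set F | {ae mu, forall x, L0_fun F x = Phi T (repr S) x :> (int -> int)}].

Definition ComFullGroup (d : symZN_metric R) (T : preAut) : Type :=
  initial_topology (fun S : com_full_group T => Phi_L0 d T (val S)).

HB.instance Definition _ (d : symZN_metric R) (T : preAut) :=
  Topological.on (ComFullGroup d T).

Lemma ComFullGroup_openE (d : symZN_metric R) (T : preAut) :
  @open (ComFullGroup d T) =
  [set (fun S : com_full_group T => Phi_L0 d T (val S)) @^-1` U | U in
    @open (L0 mu d)].
Proof. by []. Qed.

Definition com_val (d : symZN_metric R) (T : preAut)
  (S : ComFullGroup d T) : Aut := val (S : com_full_group T).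

End Aut.

(* Main.v *)
Require Import Defs.
From HB Require Import structures.
From mathcomp Require Import all_boot all_order all_algebra.
From mathcomp Require Import all_classical all_reals all_analysis.
From mathcomp Require Import lra zify.

(** Why the commensurating full group is Polish.

    At a point [x] with free orbit, an element [S] acts on the orbit of [x],
    identified with the integers by [n |-> T^n x], as the permutation
    [Phi(S)(x)]. So [S] can be recovered from the random permutation
    [coords S], and products and inverses become pointwise products and
    inverses ([coords_mul], [coords_inv]).

    The group of commensurating permutations acts faithfully on the countable
    set [CommN], and its topology is that of pointwise convergence on this set,
    taken as discrete. Convergence in measure of random permutations is
    therefore given by the countably many pseudometrics [disagr i]: the measure
    of the set of points at which the two permutations send the [i]-th element
    of [CommN] to different sets ([com_openP]). The passage from a metric [d] to
    these pseudometrics, and the continuity of the operations, both rest on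
    countable additivity: up to small probability, a random element can be
    assumed to satisfy one of an increasing sequence of conditions, such as
    sending the [i]-th set to one of finitely many sets.

    Separability ([com_separable]) comes from the separability of the measure
    algebra of [X]: up to a small error, an element is described by finitely
    many measurable sets, each taken from a countable dense family.

    For completeness ([com_dist_complete]), the pseudometrics are joined into a
    metric that also takes the inverses into account. By the Borel-Cantelli
    lemma, a Cauchy sequence has a subsequence along which almost everywhere
    the permutations and their inverses stabilize on every element of [CommN];
    they then have a commensurating limit ([symZN_limit]), and where this holds
    on the whole orbit of [x] the images of [x] stabilize as well. The
    eventual image defines the limit in the group ([com_limit]).

    Elements of the group are Borel bijections, and their inverses have to be
    Borel again; so do the negative iterates of [T], which enter in [Phi]. This
    is the Lusin-Souslin theorem ([measurable_bij_image]), proved by refining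
    the Polish topology of [X] and by Lusin's separation argument. *)

Set Implicit Arguments.
Unset Strict Implicit.
Unset Printing Implicit Defensive.

Import Order.TTheory GRing.Theory Num.Theory.
Import numFieldNormedType.Exports.

Local Open Scope classical_set_scope.
Local Open Scope ring_scope.

(** * Joining countably many pseudometrics *)

Section JoinMetric.
Variables (R : realType) (T : Type).
Implicit Types d : T -> T -> R.

Definition is_pseudometric d : Prop :=
  [/\ forall x y, 0 <= d x y, forall x, d x x = 0,
      forall x y, d x y = d y x & forall x y z, d x z <= d x y + d y z].

Lemma is_metric_pseudo d : is_metric d -> is_pseudometric d.
Proof. by move=> [d0 d00 dC dT]; split=> // x; apply/d00. Qed.

Lemma exists_invSn_lt (e : R) : 0 < e -> exists n, n.+1%:R^-1 < e.
Proof.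
by move=> e0; have [n _ /(_ n (leqnn n))] := near_infty_natSinv_lt (PosNum e0);
  exists n.
Qed.

Variable p : nat -> T -> T -> R.

(** A supremum of terms tending to 0 uniformly, rather than a series: no
    summability has to be handled, and the metric is small exactly when
    finitely many of the [p i] are. *)
Definition join_dist (x y : T) : R :=
  sup (range (fun i => i.+1%:R^-1 * Num.min 1 (p i x y))).

Hypothesis pP : forall i, is_pseudometric (p i).

Let term_ge0 i x y : 0 <= i.+1%:R^-1 * Num.min 1 (p i x y).
Proof. by rewrite mulr_ge0// le_min ler01 /=; have [] := pP i. Qed.

Let term_has_sup x y :
  has_sup (range (fun i => i.+1%:R^-1 * Num.min 1 (p i x y))).
Proof.
split; first by eexists; exists 0%N.
exists 1 => _ [i _ <-]; rewrite mulr_ile1 ?invr_le1 ?unitfE ?ltr0n ?ler1n//.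
  by rewrite le_min ler01 /=; have [] := pP i.
by rewrite ge_min lexx.
Qed.

Lemma join_dist_ub i x y :
  i.+1%:R^-1 * Num.min 1 (p i x y) <= join_dist x y.
Proof. by apply: ub_le_sup; [case: (term_has_sup x y)|exists i]. Qed.

Lemma join_dist_le x y e :
  (forall i, i.+1%:R^-1 * Num.min 1 (p i x y) <= e) -> join_dist x y <= e.
Proof.
move=> h; apply: ge_sup; first by case: (term_has_sup x y).
by move=> _ [i _ <-].
Qed.

Lemma join_dist_pseudo : is_pseudometric join_dist.
Proof.
split.
- by move=> x y; exact: le_trans (term_ge0 0 x y) (join_dist_ub 0 x y).
- move=> x; apply/eqP; rewrite eq_le (le_trans (term_ge0 0 x x) (join_dist_ub 0 x x)).
  rewrite andbT; apply: join_dist_le => i; have [_ -> _ _] := pP i.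
  by rewrite (min_idPr _) ?ler01// mulr0.
- move=> x y; congr sup; apply: eq_imagel => i _.
  by have [_ _ -> _] := pP i.
- move=> x y z; apply: join_dist_le => i.
  apply: le_trans (lerD (join_dist_ub i x y) (join_dist_ub i y z)).
  rewrite -mulrDr ler_wpM2l//; have [p0 _ _ pT] := pP i.
  have := pT x y z; have := p0 x y; have := p0 y z; rewrite !minEle.
  by do !case: ifP => ? ; lra.
Qed.

Lemma join_dist_small_below n e : 0 < e -> exists2 e', 0 < e' &
  forall x y, join_dist x y < e' -> forall i, (i < n)%N -> p i x y < e.
Proof.
move=> e0; exists (n.+1%:R^-1 * Num.min 1 e).
  by rewrite mulr_gt0// lt_min ltr01.
move=> x y xy i ni; have p0 : 0 <= Num.min 1 (p i x y).
  by rewrite le_min ler01 /=; have [] := pP i.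
have : n.+1%:R^-1 * Num.min 1 (p i x y) < n.+1%:R^-1 * Num.min 1 e.
  apply: le_lt_trans xy; apply: le_trans (join_dist_ub i x y).
  by rewrite ler_wpM2r// lef_pV2 ?posrE// ler_nat ltnS ltnW.
rewrite ltr_pM2l// lt_min !gt_min ltxx /=.
by move=> /andP[p1 /orP[/(lt_trans p1)|]].
Qed.

Lemma join_dist_small i e : 0 < e ->
  exists2 e', 0 < e' & forall x y, join_dist x y < e' -> p i x y < e.
Proof.
move=> /(join_dist_small_below i.+1)[e' e'0 h]; exists e' => // x y xy.
exact: (h _ _ xy i).
Qed.

Lemma join_dist_lt e : 0 < e -> exists n,
  forall x y, (forall i, (i < n)%N -> p i x y < e) -> join_dist x y <= e.
Proof.
move=> e0; have [n ne] := exists_invSn_lt e0; exists n.+1 => x y h.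
apply: join_dist_le => i; have [ni|ni] := ltnP i n.+1.
  rewrite -[leRHS]mul1r ler_pM ?invr_ge0 ?le_min ?ler01//=.
  - by have [] := pP i.
  - by rewrite invf_le1// ler1n.
  - by rewrite ge_min (ltW (h _ _)) ?orbT.
apply: le_trans (ltW ne); rewrite -[leRHS]mulr1 ler_pM ?invr_ge0 ?le_min ?ler01//=.
- by have [] := pP i.
- by rewrite lef_pV2 ?posrE// ler_nat ltnW.
- by rewrite ge_min lexx.
Qed.

End JoinMetric.

(** * Refining a Polish metric *)

Section PolishMetric.
Variables (R : realType) (X : Type).
Implicit Types (d : X -> X -> R) (B O : set X).

(** Separability phrased as the existence of countable partitions into small
    pieces: unlike a dense sequence, this form passes at once to subspaces and
    to suprema of metrics, and it indexes the Souslin schemes used below. *)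
Definition countably_partitioned d : Prop :=
  forall e, 0 < e -> exists c : X -> nat, forall x y, c x = c y -> d x y < e.

Definition polish_metric d : Prop :=
  [/\ is_metric d, metric_complete d & countably_partitioned d].

Definition finer d' d : Prop :=
  forall x e, 0 < e -> exists2 e', 0 < e' & forall y, d' x y < e' -> d x y < e.

Definition metric_clopen d B : Prop := metric_open d B /\ metric_open d (~` B).

Lemma finer_refl d : finer d d.
Proof. by move=> x e e0; exists e. Qed.

Lemma finer_trans d1 d2 d3 : finer d1 d2 -> finer d2 d3 -> finer d1 d3.
Proof.
move=> d12 d23 x e /(d23 x)[e' /(d12 x)[e'' e''0 h] h']; exists e'' => // y.
by move=> /h /h'.
Qed.

Lemma finer_open d d' O : finer d' d -> metric_open d O -> metric_open d' O.
Proof.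
move=> dd' oO x /oO[e /(dd' x)[e' e'0 h] hO]; exists e' => // y /h; exact: hO.
Qed.

Lemma finer_clopen d d' B : finer d' d -> metric_clopen d B -> metric_clopen d' B.
Proof. by move=> dd' [oB oCB]; split; exact: finer_open dd' _. Qed.

Lemma metric_ball_open d x e : is_metric d -> metric_open d [set y | d x y < e].
Proof.
move=> [_ _ _ dT] y /= xye; exists (e - d x y); first by rewrite subr_gt0.
by move=> z /=; rewrite ltrBrDl; exact: le_lt_trans.
Qed.

Lemma separable_countably_partitioned d :
  is_metric d -> metric_separable d -> countably_partitioned d.
Proof.
move=> [_ _ dC dT] [D cD sepD] e e0; have e20 : 0 < e / 2 by rewrite divr_gt0.
have /choice[f fP] (x : X) : exists y, D y /\ d x y < e / 2.
  by have [y Dy xy] := sepD x _ e20; exists y.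
have /pcard_leP[g] := cD.
exists (g \o f) => x y /= /(@inj _ _ _ g); rewrite !inE => /(_ (fP x).1 (fP y).1) fxy.
rewrite (le_lt_trans (dT _ (f x) _))// (splitr e) ltrD ?(fP x).2//.
by rewrite dC fxy (fP y).2.
Qed.

Lemma inv_near (b e : R) : 0 < b -> 0 < e ->
  exists2 r, 0 < r & forall a, `|a - b| < r -> `|a^-1 - b^-1| < e.
Proof.
move=> b0 e0; have /(_ _)/cvgrPdist_lt/(_ e e0) := @inv_continuous R b.
rewrite gt_eqF// => /(_ isT)/nbhs_ballP[r /= r0 h]; exists r => // a ab.
by rewrite distrC; apply: h; rewrite /ball/= distrC.
Qed.

Section MakeClopen.
Variables (d : X -> X -> R) (O : set X).

(** The truncation makes the infimum meaningful when [O] is the whole space,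
    and forces [h >= 1] on [O]; the convention [0^-1 = 0] makes [h] vanish off
    [O]. *)
Let delta x : R := inf [set r | r = 1 \/ exists2 z, ~ O z & r = d x z].

Let h x : R := (delta x)^-1.

Let d' x y : R := d x y + `|h x - h y|.

(** An open subset becomes clopen in the metric [d x y + |h x - h y|], where
    [h] is the inverse of the distance to the complement, extended by 0. The
    jump of [h] across the boundary is at least 1, and a Cauchy sequence for
    the new metric cannot run into the boundary, where [h] explodes. *)
Lemma open_refine_clopen : polish_metric d -> metric_open d O ->
  exists2 d' : X -> X -> R, polish_metric d' & finer d' d /\ metric_clopen d' O.
Proof.
move=> [dm dc dp] oO; have [d0 d00 dC dT] := dm.
have delta_lb x : has_inf [set r | r = 1 \/ exists2 z, ~ O z & r = d x z].
  by split; [exists 1; left|exists 0 => _ [->|[z _ ->]]].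
have delta1 x : delta x <= 1 by apply: ge_inf; [case: (delta_lb x)|left].
have delta_le x z : ~ O z -> delta x <= d x z.
  by move=> Oz; apply: ge_inf; [case: (delta_lb x)|right; exists z].
have delta_lip x y : delta x <= d x y + delta y.
  rewrite -lerBlDl; apply: lb_le_inf; first by case: (delta_lb y).
  move=> _ [->|[z Oz ->]]; rewrite lerBlDl.
    by rewrite (le_trans (delta1 x))// lerDr.
  exact: le_trans (delta_le _ _ Oz) (dT _ _ _).
have delta_ge0 x : 0 <= delta x.
  by apply: lb_le_inf => [|_ [->|[z _ ->]]//]; case: (delta_lb x).
have delta_out x : ~ O x -> delta x = 0.
  move=> Ox; apply/eqP; rewrite eq_le delta_ge0 andbT.
  by apply: le_trans (delta_le _ _ Ox) _; rewrite (_ : d x x = 0)//; exact/d00.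
have delta_in x : O x -> 0 < delta x.
  move=> /oO[e e0 eO]; apply: lt_le_trans (_ : Num.min 1 e <= _).
    by rewrite lt_min ltr01.
  apply: lb_le_inf; first by case: (delta_lb x).
  move=> _ [->|[z Oz ->]]; first by rewrite ge_min lexx.
  rewrite ge_min; apply/orP; right; rewrite leNgt; apply/negP => xz.
  exact/Oz/eO.
have h_ge0 x : 0 <= h x by rewrite invr_ge0.
have h_out x : ~ O x -> h x = 0 by move=> /delta_out; rewrite /h => ->; rewrite invr0.
have h_in x : O x -> 1 <= h x by move=> /delta_in ?; rewrite invf_ge1.
have dd' x y : d x y <= d' x y by rewrite lerDl.
have hd' x y : `|h x - h y| <= d' x y by rewrite lerDr.
exists d'; first split.
- split.
  + by move=> x y; rewrite addr_ge0.
  + move=> x y; split=> [xy|->]; last by rewrite /d' subrr normr0 addr0; exact/d00.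
    by apply/d00/eqP; rewrite eq_le d0 andbT -xy.
  + by move=> x y; rewrite /d' dC distrC.
  + move=> x y z; rewrite /d' addrACA lerD// (le_trans _ (ler_normD _ _))//.
    by rewrite addrA subrK.
- move=> u uC; have [|l ul] := dc u.
    move=> e /uC[N hN]; exists N => m n Nm Nn.
    exact: le_lt_trans (dd' _ _) (hN _ _ Nm Nn).
  exists l => e e0; have e20 : 0 < e / 2 by rewrite divr_gt0.
  suff [N hN] : exists N, forall n, (N <= n)%N -> `|h (u n) - h l| < e / 2.
    have [N' hN'] := ul _ e20; exists (maxn N N') => n.
    by rewrite geq_max => /andP[/hN ? /hN' ?]; rewrite (splitr e) ltrD.
  have [Ol|Ol] := pselect (O l).
    have [r r0 hr] := inv_near (delta_in _ Ol) e20.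
    have [N hN] := ul _ r0; exists N => n /hN ulr; apply: hr.
    have := delta_lip (u n) l; have := delta_lip l (u n); rewrite (dC l).
    by rewrite ltr_norml; lra.
  (* The limit is outside [O]: either the sequence ends up outside [O], or
     [h] stays bounded along it, which keeps it away from the boundary. *)
  have [N hN] := uC _ (divr_gt0 (@ltr01 R) (ltr0Sn _ 1)).
  have {}hN n : (N <= n)%N -> `|h (u n) - h (u N)| < 1 / 2.
    by move=> Nn; apply: le_lt_trans (hd' _ _) (hN _ _ Nn _).
  have [ON|ON] := pselect (O (u N)); last first.
    exists N => n /hN; rewrite !(h_out _ ON) (h_out _ Ol) subr0 => hn.
    have [On|On] := pselect (O (u n)); last by rewrite h_out// normr0.
    by have := h_in _ On; have := ler_norm (h (u n)); lra.
  have H0 : 0 < h (u N) + 1 by rewrite ltr_wpDl.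
  have [|N' hN'] := ul (h (u N) + 1)^-1; first by rewrite invr_gt0.
  have := hN (maxn N N') (leq_maxl _ _); have := hN' (maxn N N') (leq_maxr _ _).
  set x := u _ => xl; rewrite ltr_norml => /andP[h1 h2].
  have hx : 0 < h x by have := h_in _ ON; lra.
  have := delta_le x l Ol; rewrite leNgt => /negP[]; apply: (lt_le_trans xl).
  rewrite -[delta x]invrK lef_pV2 ?posrE// -/(h x); lra.
- move=> e e0; have e20 : 0 < e / 2 by rewrite divr_gt0.
  have [c cP] := dp _ e20.
  exists (fun x => pickle (c x, Num.truncn (h x / (e / 2)))) => x y.
  move=> /(pcan_inj pickleK)[/cP xy].
  have := truncn_itv (divr_ge0 (h_ge0 x) (ltW e20)).
  have := truncn_itv (divr_ge0 (h_ge0 y) (ltW e20)).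
  set a := h x / _; set b := h y / _ => bP aP tab; rewrite tab in aP.
  rewrite /d' (splitr e) ltrD// -[ltRHS]mul1r -ltr_pdivrMr//.
  rewrite -[X in _ / X](gtr0_norm e20) -normf_div mulrBl -/a -/b ltr_norml.
  by move: aP bP; rewrite -natr1; lra.
- split; first by move=> x e e0; exists e => // y; exact: le_lt_trans.
  split=> x /= Ox; exists 1 => // y /= xy.
    apply: contrapT => Oy; have := le_lt_trans (hd' x y) xy.
    rewrite (h_out _ Oy) subr0 ltNge => /negP[].
    by rewrite (le_trans (h_in _ Ox))// ler_norm.
  move=> Oy; have := le_lt_trans (hd' x y) xy.
  rewrite (h_out _ Ox) sub0r normrN ltNge => /negP[].
  by rewrite (le_trans (h_in _ Oy))// ler_norm.
Qed.

End MakeClopen.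

(** Completeness of the supremum holds because a sequence that is Cauchy for
    all the [d_ i] has, for each [i], a limit which is also its limit for the
    coarser metric [d], so that these limits coincide. *)
Lemma join_polish d (d_ : nat -> X -> X -> R) : is_metric d ->
  (forall i, polish_metric (d_ i) /\ finer (d_ i) d) ->
  polish_metric (join_dist d_) /\ forall i, finer (join_dist d_) (d_ i).
Proof.
move=> dm dP; have pP i : is_pseudometric (d_ i).
  by apply: is_metric_pseudo; case: (dP i) => -[].
have jd i x e : 0 < e ->
    exists2 e', 0 < e' & forall y, join_dist d_ x y < e' -> d_ i x y < e.
  by move=> /(join_dist_small pP i)[e' e'0 h]; exists e' => // y; exact: h.
split=> //; have [j0 j00 jC jT] := join_dist_pseudo pP; split.
- split=> // x y; split=> [xy|->//]; have [[[_ d00 _ _] _ _] _] := dP 0%N.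
  apply/d00/eqP; rewrite eq_le; have [-> _ _ _] := pP 0%N; rewrite andbT.
  apply/ler_addgt0Pl => e /(jd 0%N x)[e' e'0 h]; rewrite addr0 ltW// h//.
  by rewrite xy.
- move=> u uC.
  have /choice[l lP] i : exists l, forall e, 0 < e ->
      exists N, forall n, (N <= n)%N -> d_ i (u n) l < e.
    have [[_ ic _] _] := dP i; apply: ic => e /(join_dist_small pP i)[e' e'0 h].
    by have [N hN] := uC _ e'0; exists N => m n Nm Nn; apply/h/hN.
  have [d0 d00 dC dT] := dm.
  have ul i e : 0 < e -> exists N, forall n, (N <= n)%N -> d (u n) (l i) < e.
    have [_ fi] := dP i => /(fi (l i))[e' /(lP i)[N hN] h]; exists N => n /hN.
    by have [_ _ -> _] := pP i; rewrite dC; exact: h.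
  have lE i : l i = l 0%N.
    apply/d00/eqP; rewrite eq_le d0 andbT; apply/ler_addgt0Pl => e e0.
    have e20 : 0 < e / 2 by rewrite divr_gt0.
    have [N hN] := ul i _ e20; have [N' hN'] := ul 0%N _ e20.
    rewrite addr0 (le_trans (dT _ (u (maxn N N')) _))// (splitr e) dC.
    by rewrite lerD// ltW ?hN ?hN' ?leq_maxl ?leq_maxr.
  exists (l 0%N) => e e0; have e20 : 0 < e / 2 by rewrite divr_gt0.
  have [n hn] := join_dist_lt pP e20.
  have /choice[N hN] i : exists N, forall n, (N <= n)%N -> d_ i (u n) (l 0%N) < e / 2.
    by have [N hN] := lP i _ e20; exists N => m; rewrite -(lE i); exact: hN.
  exists (\max_(i < n) N i) => m Nm; apply: (@le_lt_trans _ _ (e / 2)); last lra.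
  apply: hn => i ni; apply: hN; apply: leq_trans Nm.
  exact: (leq_bigmax (Ordinal ni)).
- move=> e e0; have e20 : 0 < e / 2 by rewrite divr_gt0.
  have [n hn] := join_dist_lt pP e20.
  have /choice[c cP] i : exists c : X -> nat, forall x y, c x = c y -> d_ i x y < e / 2.
    by have [[_ _ ic] _] := dP i; exact: ic.
  exists (fun x => pickle [seq c i x | i <- iota 0 n]) => x y /(pcan_inj pickleK) cxy.
  apply: (@le_lt_trans _ _ (e / 2)); last lra.
  apply: hn => i ni; apply: cP; have /eq_in_map := cxy; apply.
  by rewrite mem_iota.
Qed.

(** The sets that can be made clopen form a sigma-algebra: for a countable
    union, join the refinements given by its members; the union becomes open,
    and one more refinement makes it clopen. *)
Lemma borel_refine_clopen d B : polish_metric d -> <<s metric_open d >> B ->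
  exists2 d', polish_metric d' & finer d' d /\ metric_clopen d' B.
Proof.
move=> dP; move: B; apply: (@smallest_sub _ _ _ [set B : set X |
  exists2 d', polish_metric d' & finer d' d /\ metric_clopen d' B]) => [|O oO];
  last exact: open_refine_clopen.
split=> [|A [d' d'P [d'd [oA oCA]]]|F FP].
- exists d => //; split; first exact: finer_refl.
  by split=> [x []|x _]; exists 1 => // y _ [].
- rewrite setTD; exists d' => //; split=> //; split=> //.
  by rewrite setCK.
- have /choice[d_ dP_] i : exists d', [/\ polish_metric d', finer d' d &
      metric_clopen d' (F i)] by have [d' ? []] := FP i; exists d'.
  have dm : is_metric d by case: dP.
  have [i|jP jf] := @join_polish d d_ dm; first by have [] := dP_ i.
  have [|d' d'P [d'j d'F]] := @open_refine_clopen _ (\bigcup_i F i) jP.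
    move=> x [i _ Fix]; have [_ _ [oF _]] := dP_ i.
    have [e e0 eF] := finer_open (jf i) oF Fix.
    by exists e => // y /eF Fiy; exists i.
  exists d' => //; split=> //; apply: finer_trans d'j _.
  apply: finer_trans (jf 0%N) _; by have [] := dP_ 0%N.
Qed.

End PolishMetric.

(** * Standard Borel spaces and the Lusin-Souslin theorem *)

Section StandardBorel.
Variables (R : realType) (disp : measure_display) (X : measurableType disp).

Lemma standard_borel_base : standard_borel R X ->
  exists (rho : X -> X -> R) (G : nat -> set X),
    [/\ polish_metric rho, @measurable disp X = <<s metric_open rho >>,
        forall n, metric_open rho (G n) &
        forall x e, 0 < e -> exists2 n, G n x & G n `<=` [set y | rho x y < e]].
Proof.
move=> [rho [rhom rhoc rhos mE]]; have [d0 d00 dC dT] := rhom.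
have [D cD sepD] := rhos; have /pcard_leP[g] := cD.
pose G n := if unpickle n is Some (i, k)
  then [set x | exists2 y, D y /\ g y = i & rho y x < k.+1%:R^-1] else set0.
exists rho, G; split=> //.
- by split=> //; exact: separable_countably_partitioned.
- move=> n x; rewrite /G; case: unpickle => [[i k]|[]] [y Dy yx].
  have [e e0 he] := @metric_ball_open _ _ rho y k.+1%:R^-1 rhom x yx.
  by exists e => // z /he; exists y.
- move=> x e e0; have [k ke] := @exists_invSn_lt R _ (divr_gt0 e0 (ltr0Sn _ 1)).
  have [|y Dy xy] := sepD x k.+1%:R^-1; first by rewrite invr_gt0.
  exists (pickle (g y : nat, k)); rewrite /G pickleK.
    by exists y => //; rewrite dC.
  move=> z [y' [Dy' /(@inj _ _ _ g)]]; rewrite !inE => /(_ Dy' Dy) -> yz /=.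
  rewrite (le_lt_trans (dT _ y _))// (splitr e) ltrD//.
    exact: lt_trans ke.
  exact: lt_trans ke.
Qed.

Lemma standard_borel_generators : standard_borel R X ->
  exists G : nat -> set X,
    @measurable disp X = <<s range G >> /\
    forall x y, x <> y -> exists2 n, G n x & ~ G n y.
Proof.
move=> /standard_borel_base[rho [G [[[d0 d00 dC dT] _ _] mE oG baseG]]].
exists G; split.
  rewrite mE; apply/seteqP; split; apply: smallest_sub.
  - exact: smallest_sigma_algebra.
  - move=> O oO.
    pose F n := if `[< G n `<=` O >] then G n else set0.
    rewrite (_ : O = \bigcup_n F n).
      apply: sigma_algebra_bigcup => n; rewrite /F; case: ifP => _.
        by apply: sub_gen_smallest; exists n.
      exact: sigma_algebra0.
    apply/seteqP; split=> [x /oO[e /(baseG x)[n Gnx Gne] eO]|x [n _]].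
      by exists n => //; rewrite /F ifT//; apply/asboolP => y /Gne/eO.
    by rewrite /F; case: ifP => // /asboolP; exact.
  - exact: smallest_sigma_algebra.
  - by move=> _ [n _ <-]; apply: sub_gen_smallest; exact: oG.
move=> x y xy; have rxy : 0 < rho x y.
  by rewrite lt_def d0 andbT; apply/eqP => /d00.
have [n Gnx Gne] := baseG x _ rxy; exists n => //.
by move=> /Gne /=; rewrite ltxx.
Qed.

(** Countably many Borel sets suffice to tell [f x] from [g x]. *)
Lemma measurable_eq_fun (f g : X -> X) : standard_borel R X ->
  measurable_fun setT f -> measurable_fun setT g ->
  measurable [set x | f x = g x].
Proof.
move=> /standard_borel_generators[G [mE sepG]] mf mg.
have mG n : measurable (G n) by rewrite mE; apply: sub_gen_smallest; exists n.
rewrite -[X in measurable X]setCK; apply: measurableC.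
rewrite (_ : ~` _ = \bigcup_n (f @^-1` G n `\` g @^-1` G n)).
  apply: bigcupT_measurable => n.
  by apply: measurableD; rewrite -[X in measurable X]setTI; [exact: mf|exact: mg].
apply/seteqP; split=> [x /= /sepG[n ? ?]|x [n _ [/= fx gx] fg]]; first by exists n.
by apply: gx; rewrite -fg.
Qed.

Definition borel_separated (P Q : set X) :=
  exists2 M, measurable M & P `<=` M /\ M `&` Q = set0.

(** Separate each [P n] from all the [Q m] by a countable intersection. *)
Lemma bigcup_borel_separated (P Q : nat -> set X) :
  (forall n m, borel_separated (P n) (Q m)) ->
  borel_separated (\bigcup_n P n) (\bigcup_m Q m).
Proof.
move=> PQ; have /choice[M MP] (nm : nat * nat) : exists M, [/\ measurable M,
    P nm.1 `<=` M & M `&` Q nm.2 = set0].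
  by have [M ? []] := PQ nm.1 nm.2; exists M.
exists (\bigcup_n \bigcap_m M (n, m)).
  apply: bigcupT_measurable => n; apply: bigcapT_measurable => m.
  by have [] := MP (n, m).
split=> [x [n _ Px]|].
  by exists n => // m _; have [_ + _] := MP (n, m); exact.
rewrite -subset0 => x [[n _ Mx] [m _ Qx]].
by have [_ _ <-] := MP (n, m); split=> //; exact: Mx.
Qed.

(** Lusin's separation theorem. If the images of [B] and of its complement
    could not be separated, then neither could those of smaller and smaller
    cells of the countable partitions; the cells shrink to points [x] of [B]
    and [y] outside [B], and disjoint balls around [f x] and [f y] would
    separate the images of small cells. *)
Lemma image_clopen_separated (rho d : X -> X -> R) (f : X -> X) B :
  is_metric rho -> @measurable disp X = <<s metric_open rho >> ->
  polish_metric d -> metric_clopen d B -> injective f ->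
  (forall x e, 0 < e ->
    exists2 e', 0 < e' & forall y, d x y < e' -> rho (f x) (f y) < e) ->
  borel_separated (f @` B) (f @` (~` B)).
Proof.
move=> rhom mE [dm dc dp] [oB oCB] fI fcont; have [_ _ dC dT] := dm.
have [r0 r00 rC rT] := rhom.
have /choice[c cP] k : exists c : X -> nat,
    forall x y, c x = c y -> d x y < k.+1%:R^-1 by exact: dp.
pose cell k (P : set X * set X) (nm : nat * nat) :=
  (P.1 `&` c k @^-1` [set nm.1], P.2 `&` c k @^-1` [set nm.2]).
pose sep (P : set X * set X) := borel_separated (f @` P.1) (f @` P.2).
apply: contrapT => nsep.
have /choice[g gP] (kP : nat * (set X * set X)) :
    exists nm, ~ sep kP.2 -> ~ sep (cell kP.1 kP.2 nm).
  case: kP => k P /=; have [sP|nsP] := pselect (sep P); first by exists (0, 0)%N.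
  apply: contrapT => /forallNP h; apply: nsP; rewrite /sep.
  have cover (A : set X) : f @` A = \bigcup_n (f @` (A `&` c k @^-1` [set n])).
    apply/seteqP; split=> [_ [x Ax <-]|_ [n _ [x [Ax _] <-]]]; last by exists x.
    by exists (c k x) => //; exists x.
  rewrite (cover P.1) (cover P.2); apply: bigcup_borel_separated => n m.
  by apply: contrapT => hs; apply: (h (n, m)).
(* Two decreasing sequences of cells, chosen so that their images are never
   separated. *)
pose P := fix P k := if k is k'.+1 then cell k' (P k') (g (k', P k')) else (B, ~` B).
have nsP k : ~ sep (P k).
  by elim: k => [|k IH]; [exact: nsep|exact: (gP (k, P k) IH)].
have PS k l : (k <= l)%N -> (P l).1 `<=` (P k).1 /\ (P l).2 `<=` (P k).2.
  elim: l => [|l IH]; first by rewrite leqn0 => /eqP ->; split.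
  rewrite leq_eqVlt ltnS => /predU1P[->|/IH[h1 h2]]; first by split.
  by split=> [x [/h1]|x [/h2]].
have P1d k x y : (P k.+1).1 x -> (P k.+1).1 y -> d x y < k.+1%:R^-1.
  by move=> /= [_ cx] [_ cy]; apply: cP; rewrite cx.
have P2d k x y : (P k.+1).2 x -> (P k.+1).2 y -> d x y < k.+1%:R^-1.
  by move=> /= [_ cx] [_ cy]; apply: cP; rewrite cx.
have /choice[u uP] k : exists x, (P k).1 x.
  apply: contrapT => /forallNP h; apply: (nsP k); exists set0 => //.
  by split; [move=> _ [x /h[]]|rewrite set0I].
have /choice[v vP] k : exists x, (P k).2 x.
  apply: contrapT => /forallNP h; apply: (nsP k); exists setT => //.
  by split=> //; rewrite setTI -subset0 => _ [x /h[]].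
have cauchy (w : nat -> X) (Q : nat -> set X) : (forall k, Q k (w k)) ->
    (forall k l, (k <= l)%N -> Q l `<=` Q k) ->
    (forall k x y, Q k.+1 x -> Q k.+1 y -> d x y < k.+1%:R^-1) ->
    exists x, (forall e, 0 < e -> exists k, forall y, Q k y -> d x y < e).
  move=> wQ QS Qd; have [e e0|x wx] := dc w.
    have [k ke] := exists_invSn_lt e0; exists k.+1 => m n km kn.
    by apply: lt_trans ke; apply: Qd; [exact: QS km _ _|exact: QS kn _ _].
  exists x => e e0; have e20 : 0 < e / 2 by rewrite divr_gt0.
  have [k ke] := exists_invSn_lt e20; have [N hN] := wx _ e20.
  exists k.+1 => y Qy; rewrite (le_lt_trans (dT _ (w (maxn N k.+1)) _))//.
  rewrite (splitr e) ltrD//; first by rewrite dC hN// leq_maxl.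
  by apply: lt_trans ke; apply: Qd => //; exact: QS (leq_maxr _ _) _ _.
have [x xP] := cauchy u (fun k => (P k).1) uP (fun k l kl => (PS k l kl).1) P1d.
have [y yP] := cauchy v (fun k => (P k).2) vP (fun k l kl => (PS k l kl).2) P2d.
have Bx : B x.
  apply: contrapT => /oCB[e /xP[k hk] eB]; apply: (eB _ (hk _ (uP k))).
  exact: (PS 0%N k (leq0n k)).1.
have By : ~ B y.
  move=> /oB[e /yP[k hk] eB]; apply: (PS 0%N k (leq0n k)).2 (vP k) _.
  exact: eB (hk _ (vP k)).
have fxy : 0 < rho (f x) (f y) / 2.
  rewrite divr_gt0// lt_def r0 andbT; apply/eqP => /r00/fI xy.
  by apply: By; rewrite -xy.
have [ex ex0 hx] := fcont x _ fxy; have [ey ey0 hy] := fcont y _ fxy.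
have [k hk] := xP _ ex0; have [l hl] := yP _ ey0.
apply: (nsP (maxn k l)); exists [set z | rho (f x) z < rho (f x) (f y) / 2].
  by rewrite mE; apply: sub_gen_smallest; exact: metric_ball_open.
split=> [_ [z zP <-]|]; first exact/hx/hk/(PS k _ (leq_maxl k l)).1.
rewrite -subset0 => w [/= fxw [z zP zw]]; move: fxw; rewrite -zw => fxz.
have fyz : rho (f y) (f z) < rho (f x) (f y) / 2.
  exact/hy/hl/(PS l _ (leq_maxr k l)).2.
have := rT (f x) (f z) (f y); rewrite (rC (f z)); lra.
Qed.

(** The Lusin-Souslin theorem, for bijections: in a suitable finer Polish
    metric the Borel set [B] is clopen and [f] is continuous, so that [f @` B]
    and its complement are separated by a Borel set, which has to be
    [f @` B]. *)
Lemma measurable_bij_image (f : X -> X) B : standard_borel R X ->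
  bijective f -> measurable_fun setT f -> measurable B -> measurable (f @` B).
Proof.
move=> sX fb mf mB.
have [rho [G [rhop mE oG baseG]]] := standard_borel_base sX.
have [rhom _ _] := rhop.
(* Besides [B], the preimages of a base, so as to make [f] continuous. *)
pose A n := if n is n'.+1 then f @^-1` G n' else B.
have mA n : measurable (A n).
  case: n => [//|n]; rewrite -[X in measurable X]setTI; apply: mf => //.
  by rewrite mE; apply: sub_gen_smallest; exact: oG.
have /choice[d_ dP_] n : exists d,
    [/\ polish_metric d, finer d rho & metric_clopen d (A n)].
  have := mA n; rewrite mE => /(borel_refine_clopen rhop)[d dp [dr dA]].
  by exists d.
have [i|dp df] := @join_polish _ _ rho d_ rhom; first by have [] := dP_ i.
have clA n : metric_clopen (join_dist d_) (A n).
  by apply: finer_clopen (df n) _; have [] := dP_ n.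
have [|M mM [fM Mf]] := @image_clopen_separated rho (join_dist d_) f B rhom mE dp
    (clA 0%N) (bij_inj fb).
  move=> x e /(baseG (f x))[n Gn Gne]; have [oA _] := clA n.+1.
  by have [e' e'0 he'] := oA x Gn; exists e' => // y /he'/Gne.
rewrite (_ : f @` B = M)//; apply/seteqP; split=> // y My.
case: fb => g gK fK; rewrite -(fK y).
have [Bg|Bg] := pselect (B (g y)); first by exists (g y).
exfalso; rewrite -[False]/(set0 y) -Mf; split=> //; exists (g y) => //; exact: fK.
Qed.

End StandardBorel.

(** * Approximation in probability spaces *)

Lemma measurableY d (X : measurableType d) (A B : set X) :
  measurable A -> measurable B -> measurable (A `+` B).
Proof. by move=> mA mB; rewrite setY_def; apply: measurableU; exact: measurableD. Qed.

Section Approximation.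
Variables (R : realType) (disp : measure_display) (X : measurableType disp).
Variable mu : probability X R.

Definition pr (A : set X) : R := fine (mu A).

Lemma prE A : measurable A -> mu A = (pr A)%:E.
Proof. by move=> mA; rewrite fineK// fin_num_measure. Qed.

Lemma pr_ge0 A : 0 <= pr A.
Proof. exact: fine_ge0. Qed.

Lemma pr0 : pr set0 = 0.
Proof. by rewrite /pr measure0. Qed.

Lemma le_pr A B : measurable A -> measurable B -> A `<=` B -> pr A <= pr B.
Proof.
by move=> mA mB AB; rewrite -lee_fin -!prE// le_measure// inE.
Qed.

Lemma prU A B : measurable A -> measurable B -> pr (A `|` B) <= pr A + pr B.
Proof.
move=> mA mB; rewrite -lee_fin EFinD -!prE//; last exact: measurableU.
exact: measureU2.
Qed.

Lemma pr_bigsetU (F : nat -> set X) n : (forall i, measurable (F i)) ->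
  pr (\big[setU/set0]_(i < n) F i) <= \sum_(i < n) pr (F i).
Proof.
move=> mF; elim: n => [|n IH]; first by rewrite !big_ord0 pr0.
rewrite !big_ord_recr /= (le_trans (prU _ _))//; last by rewrite lerD2r.
exact: bigsetU_measurable.
Qed.

(** Continuity from above, in the form used to truncate. *)
Lemma pr_decreasing_small (A : nat -> set X) e : 0 < e ->
  (forall n, measurable (A n)) -> (forall m n, (m <= n)%N -> A n `<=` A m) ->
  mu (\bigcap_n A n) = 0%E -> exists n, pr (A n) < e.
Proof.
move=> e0 mA decA A0.
have : mu (A n) @[n --> \oo] --> mu (\bigcap_n A n).
  apply: nonincreasing_cvg_mu.
  - by apply: (le_lt_trans (probability_le1 mu (mA 0%N))); rewrite ltry.
  - exact: mA.
  - exact: bigcapT_measurable.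
  - by move=> m n mn; apply/subsetPset/decA.
rewrite A0 => /fine_cvgP[_] /cvgrPdist_lt/(_ e e0)[n _ /(_ n (leqnn n))].
by rewrite /= sub0r normrN ger0_norm ?pr_ge0// => ?; exists n.
Qed.

Lemma le_pr_ae A B : measurable A -> measurable B ->
  {ae mu, forall x, A x -> B x} -> pr A <= pr B.
Proof.
move=> mA mB [N [mN N0 NAB]].
have mBN : measurable (B `|` N) by exact: measurableU.
apply: (@le_trans _ _ (pr (B `|` N))).
  apply: le_pr => // x Ax; apply: contrapT => /not_orP[nB nN].
  by apply/nN/NAB => /= /(_ Ax).
by apply: le_trans (prU mB mN) _; rewrite /pr N0 addr0.
Qed.

Lemma pr_eq0_negligible A : measurable A -> pr A = 0 -> mu.-negligible A.
Proof. by move=> mA A0; exists A; split=> //; have := prE mA; rewrite A0. Qed.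

(** Almost everywhere convergence implies convergence in measure. *)
Lemma ae_eventually_small (A : nat -> set X) e : 0 < e ->
  (forall n, measurable (A n)) ->
  {ae mu, forall x, exists n, forall m, (n <= m)%N -> ~ A m x} ->
  exists n, forall m, (n <= m)%N -> pr (A m) < e.
Proof.
move=> e0 mA [N [mN N0 AN]].
pose B n := \bigcup_(m >= n) A m.
have mB n : measurable (B n) by exact: bigcup_measurable.
have [m n mn x [k /= nk Ak]||n nB] := pr_decreasing_small e0 mB.
- by exists k => //=; exact: leq_trans nk.
- apply/(negligibleP _ (bigcapT_measurable mB)); exists N; split=> // x BN.
  by apply: AN => -[n nA]; have [m nm Am] := BN n I; exact: nA Am.
- exists n => m nm; apply: le_lt_trans nB; apply: le_pr => // x Am.
  by exists m.
Qed.

Lemma borel_cantelli_geometric (A : nat -> set X) : (forall n, measurable (A n)) ->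
  (forall n, pr (A n) <= 1 / (2 ^ n.+1)%:R) ->
  {ae mu, forall x, exists n, forall m, (n <= m)%N -> ~ A m x}.
Proof.
move=> mA A2; have := lim_sup_set_cvg0 mA.
have : (\sum_(n <oo) mu (A n) < +oo)%E.
  apply: (@le_lt_trans _ _ 1%E); last by rewrite ltry.
  apply: le_trans (epsilon_trick0 xpredT (@ler01 R)).
  by apply: lee_nneseries => // n _; rewrite (prE (mA n)) lee_fin.
move=> /[swap] /[apply] A0; exists (lim_sup_set A); split=> //.
  by apply: bigcapT_measurable => n; exact: bigcup_measurable.
move=> x nA n _; apply: contrapT => h; apply: nA; exists n => m nm Am.
by apply: h; exists m.
Qed.

(** The bookkeeping of all the truncation arguments: up to a null set, [A] is
    covered by an exceptional set and finitely many sets of small measure. *)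
Lemma pr_cover (A B : set X) (C : nat -> set X) n e :
  measurable A -> measurable B -> (forall j, measurable (C j)) ->
  {ae mu, forall x, A x -> B x \/ exists2 j, (j < n)%N & C j x} ->
  0 < e -> pr B <= e / 2 -> (forall j, (j < n)%N -> pr (C j) < e / 2 / n.+1%:R) ->
  pr A < e.
Proof.
move=> mA mB mC ABC e0 Be Ce.
have mU : measurable (\big[setU/set0]_(j < n) C j) by exact: bigsetU_measurable.
apply: (@le_lt_trans _ _ (pr (B `|` \big[setU/set0]_(j < n) C j))).
  apply: le_pr_ae => //; first exact: measurableU.
  apply: filterS ABC => x ABC /ABC[Bx|[j jn Cj]]; first by left.
  by right; rewrite -bigcup_mkord; exists j.
apply: le_lt_trans (prU mB mU) _.
rewrite (splitr e) ler_ltD//; apply: le_lt_trans (pr_bigsetU _ mC) _.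
apply: (@le_lt_trans _ _ (\sum_(j < n) e / 2 / n.+1%:R)).
  by apply: ler_sum => j _; exact/ltW/Ce.
rewrite sumr_const card_ord -[_ *+ n]mulr_natr -(mulrA (e / 2)) gtr_pMr ?divr_gt0//.
by rewrite mulrC ltr_pdivrMr ?ltr0n// mul1r ltr_nat.
Qed.

(** Boolean combinations of the [G n], coded by trees so as to be countable:
    a node is the complement of the union of its children. *)
Fixpoint bool_comb (G : nat -> set X) (t : GenTree.tree nat) : set X :=
  match t with
  | GenTree.Leaf n => G n
  | GenTree.Node _ l => ~` foldr (fun t A => bool_comb G t `|` A) set0 l
  end.

Lemma measurable_bool_comb G t :
  (forall n, measurable (G n)) -> measurable (bool_comb G t).
Proof.
move=> mG; move: t; fix IH 1; case=> [n|n l]; first exact: mG.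
apply: measurableC; elim: l => [|t l IHl]; first exact: measurable0.
exact: measurableU (IH t) IHl.
Qed.

(** Separability of the measure algebra: the sets approximated by Boolean
    combinations of countably many generators form a sigma-algebra, a
    countable union being approximated by its finite subunions. *)
Lemma measure_algebra_separable : standard_borel R X ->
  exists A : nat -> set X, (forall n, measurable (A n)) /\
    forall B e, measurable B -> 0 < e -> exists n, pr (B `+` A n) < e.
Proof.
move=> /standard_borel_generators[G [mE _]].
have mG n : measurable (G n) by rewrite mE; apply: sub_gen_smallest; exists n.
have mt := measurable_bool_comb _ mG.
exists (fun n => bool_comb G (odflt (GenTree.Leaf 0%N) (unpickle n))); split=> //.
move=> B e mB e0.
suff [t tB] : exists t, pr (B `+` bool_comb G t) < e.
  by exists (pickle t); rewrite pickleK.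
have sub3 (C D E : set X) : measurable C -> measurable D -> measurable E ->
    pr (C `+` E) <= pr (C `+` D) + pr (D `+` E).
  move=> mC mD mE'; apply: le_trans (prU _ _); rewrite ?le_pr//.
  - exact: measurableY.
  - by apply: measurableU; exact: measurableY.
  - rewrite !setY_def => x; rewrite /= /setU /=.
    by have [] := pselect (D x); tauto.
  - exact: measurableY.
  - exact: measurableY.
pose M := [set B : set X | measurable B /\ forall e, 0 < e ->
  exists t, pr (B `+` bool_comb G t) < e].
suff : <<s range G >> `<=` M by move=> /(_ B); rewrite -mE => /(_ mB)[_]; exact.
have MC C : M C -> M (~` C).
  move=> [mC Ct]; split; first exact: measurableC.
  move=> r /Ct[t tr]; exists (GenTree.Node 0 [:: t]); rewrite /= setU0.
  suff -> : ~` C `+` ~` bool_comb G t = C `+` bool_comb G t by [].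
  rewrite !setY_def !setDE !setCK setUC; congr (_ `|` _); rewrite setIC//.
have M0 : M set0.
  split=> // r r0; exists (GenTree.Node 0 [:: GenTree.Node 0 [::]]).
  by rewrite /= setU0 setCK setYK pr0.
have MU C D : M C -> M D -> M (C `|` D).
  move=> [mC Ct] [mD Dt]; split; first exact: measurableU.
  move=> r r0; have r20 : 0 < r / 2 by rewrite divr_gt0.
  have [t tr] := Ct _ r20; have [s sr] := Dt _ r20.
  exists (GenTree.Node 0 [:: GenTree.Node 0 [:: t; s]]); rewrite /= !setU0 setCK.
  rewrite (splitr r); apply: le_lt_trans (ltrD tr sr).
  apply: le_trans (prU _ _); first apply: le_pr.
  - by apply: measurableY; exact: measurableU.
  - by apply: measurableU; exact: measurableY.
  - by rewrite !setY_def => x; rewrite /= /setU /setD /=; tauto.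
  - exact: measurableY.
  - exact: measurableY.
apply: smallest_sub => [|_ [n _ <-]]; last first.
  by split=> // r r0; exists (GenTree.Leaf n); rewrite /= setYK pr0.
split=> // [C MC'|F MF]; first by rewrite setTD; exact: MC.
have mF n : measurable (F n) by have [] := MF n.
have MFn n : M (\bigcup_(i < n) F i).
  elim: n => [|n IH]; first by rewrite bigcup_mkord big_ord0.
  by rewrite bigcup_mkord big_ord_recr /= -bigcup_mkord; exact: MU.
split; first exact: bigcupT_measurable.
move=> r r0; have r20 : 0 < r / 2 by rewrite divr_gt0.
have [n|m n mn x [Fx nx]||n nr] := @pr_decreasing_small
    (fun n => \bigcup_i F i `\` \bigcup_(i < n) F i) _ r20.
- by apply: measurableD; [exact: bigcupT_measurable|have [] := MFn n].
- by split=> // -[i /= im Fi]; apply: nx; exists i => //=; exact: leq_trans mn.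
- rewrite (_ : \bigcap_n _ = set0) ?measure0// -subset0 => x h.
  have [[i _ Fi] _] := h 0%N I; have [_] := h i.+1 I; apply.
  by exists i => /=.
have [mU /(_ _ r20)[t tr]] := MFn n; exists t.
rewrite (splitr r); apply: le_lt_trans (ltrD nr tr).
apply: le_trans (sub3 _ (\bigcup_(i < n) F i) _ _ _ _) _ => //.
  exact: bigcupT_measurable.
rewrite lerD2r setY_def (_ : \bigcup_(i < n) F i `\` _ = set0) ?setU0//.
by rewrite -subset0 => x [[i _ Fi]]; apply; exists i.
Qed.

End Approximation.

(** * The group of permutations commensurating the natural numbers *)

Section SymZNAction.
Implicit Types (s t : symZN).

(** [CommN] is countable, being indexed by the finite sets of integers; the
    default [[::]] stands for [natZ] itself. *)
Definition comm (i : nat) : set int := CommN_of (odflt [::] (unpickle i)).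

Lemma commP M : CommN M <-> exists i, M = comm i.
Proof.
split=> [/CommN_ofP[F ->]|[i ->]]; last by apply/CommN_ofP; eexists.
by exists (pickle F); rewrite /comm pickleK.
Qed.

Lemma comm_natZ : exists i, comm i = natZ.
Proof.
have /commP[i] : CommN natZ by rewrite /CommN /= setYK.
by exists i.
Qed.

Lemma symZN_image_comm s i : exists j, s @` comm i = comm j.
Proof. by apply/commP/symZN_image_CommN/commP; exists i. Qed.

Lemma symZN_inj s : injective s.
Proof. exact/bij_inj/(symZNP s).1. Qed.

Lemma symZN_invK s : cancel s (s^-1)%g.
Proof. exact/bij_invK/(symZNP s).1. Qed.

Lemma symZN_invVK s : cancel (s^-1)%g s.
Proof. exact/bij_invVK/(symZNP s).1. Qed.

Lemma symZN_mul_image s t M : (s * t)%g @` M = s @` (t @` M).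
Proof. by rewrite image_comp. Qed.

Lemma symZN_image_inv s M M' : (s^-1)%g @` M = M' <-> s @` M' = M.
Proof.
split=> <-; rewrite image_comp -[RHS]image_id; apply: eq_imagel => n _ /=.
  exact: symZN_invVK.
exact: symZN_invK.
Qed.

(** The point [s n] is the difference of the images of [natZ] with and
    without [n]. *)
Lemma symZN_eval n : exists i j, forall s t,
  s @` comm i = t @` comm i -> s @` comm j = t @` comm j -> s n = t n.
Proof.
have /commP[i iE] : CommN (natZ `|` [set n]).
  apply: (@sub_finite_set _ _ [set n]); last exact: finite_set1.
  rewrite setY_def => x /= [[[Nx|->//] nx]|[Nx nx]]; exfalso; apply: nx => //.
  by left.
have /commP[j jE] : CommN (natZ `\ n).
  apply: (@sub_finite_set _ _ [set n]); last exact: finite_set1.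
  rewrite setY_def => x /= [[[Nx _] nx]|[Nx nx]]; first by [].
  by apply: contrapT => xn; apply: nx.
exists i, j => s t; rewrite -iE -jE => sti stj.
have [m [Nm|->//] tm] : (t @` (natZ `|` [set n])) (s n).
  by rewrite -sti; exists n => //; right.
have [mn|/eqP mn] := eqVneq m n; first by rewrite -tm mn.
have [k [_ kn] /symZN_inj//] : (s @` (natZ `\ n)) (s n).
by rewrite stj; exists m.
Qed.

Lemma symZN_eq s t : (forall i, s @` comm i = t @` comm i) -> s = t.
Proof.
move=> st; apply/val_inj/funext => n /=.
by have [i [j]] := symZN_eval n; apply.
Qed.

Definition eventually_constant (A : Type) (u : nat -> A) :=
  exists N, forall k, (N <= k)%N -> u k = u N.

(** Completeness of the two-sided uniformity: the stabilized values of the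
    inverses provide the inverse of the limit. Without them the limit could
    fail to be onto, as for the cycles [0 -> 1 -> ... -> k -> 0]. *)
Lemma symZN_limit (u : nat -> symZN) :
  (forall i, eventually_constant (fun k => u k @` comm i)) ->
  (forall i, eventually_constant (fun k => (u k)^-1%g @` comm i)) ->
  exists s : symZN,
    (forall i, exists N, forall k, (N <= k)%N -> u k @` comm i = s @` comm i) /\
    (forall n, exists N, forall k, (N <= k)%N -> u k n = s n).
Proof.
have pointwise (v : nat -> symZN) :
    (forall i, eventually_constant (fun k => v k @` comm i)) ->
    exists s : int -> int, forall n, exists N, forall k, (N <= k)%N -> v k n = s n.
  move=> vP; suff /choice[s sP] : forall n, exists m, exists N, forall k,
    (N <= k)%N -> v k n = m by exists s.
  move=> n; have [i [j ij]] := symZN_eval n.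
  have [N hN] := vP i; have [N' hN'] := vP j.
  exists (v (maxn N N') n), (maxn N N') => k kN; apply: ij.
    rewrite hN; first by rewrite [RHS]hN// leq_maxl.
    exact: leq_trans (leq_maxl _ _) kN.
  rewrite hN'; first by rewrite [RHS]hN'// leq_maxr.
  exact: leq_trans (leq_maxr _ _) kN.
move=> uP uVP; have [s sP] := pointwise _ uP; have [s' s'P] := pointwise _ uVP.
have s's : cancel s s'.
  move=> n; have [N hN] := sP n; have [N' hN'] := s'P (s n).
  rewrite -(hN' _ (leq_maxr N N')) -(hN _ (leq_maxl N N')); exact: symZN_invK.
have ss' : cancel s' s.
  move=> n; have [N hN] := s'P n; have [N' hN'] := sP (s' n).
  rewrite -(hN' _ (leq_maxr N N')) -(hN _ (leq_maxl N N')); exact: symZN_invVK.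
have lim i : exists N, forall k, (N <= k)%N -> u k @` comm i = s @` comm i.
  have [N hN] := uP i; exists N => k /hN ->; apply/seteqP; split=> [y uy|_ [n Mn <-]].
    have [N' hN'] := s'P y; exists (s' y) => //.
    rewrite -(hN' _ (leq_maxr N N')); move: uy; rewrite -(hN _ (leq_maxl N N')).
    by move=> [x Mx <-]; rewrite symZN_invK.
  have [N' hN'] := sP n; rewrite -(hN' _ (leq_maxr N N')).
  by rewrite -(hN _ (leq_maxl N N')); exists n.
have sc : commensurating s.
  split; first by exists s'.
  have [i iE] := comm_natZ; have [N /(_ _ (leqnn N)) hN] := lim i.
  rewrite -iE -hN; apply: symZN_image_CommN; rewrite iE.
  by rewrite /CommN /= setYK.
by exists (SymZN (asboolT sc)).
Qed.

(** For fixed [s], the sets of such [t] form a neighbourhood basis at [s]. *)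
Definition agree_below (n : nat) s t :=
  forall i, (i < n)%N -> s @` comm i = t @` comm i.

Lemma symZN_open_agree (U : set symZN) s : open U -> U s ->
  exists n, forall t, agree_below n s t -> U t.
Proof.
move=> oU /(symZN_baseP oU)[l sl lU].
exists (\max_(p <- l) (pickle p.1).+1) => t st; apply: lU => p pl.
have := st (pickle p.1); rewrite /comm pickleK /= (sl _ pl) => <- //.
by rewrite (big_rem p)//= leq_max leqnn.
Qed.

Lemma agree_symZN_open (U : set symZN) :
  (forall s, U s -> exists n, forall t, agree_below n s t -> U t) -> open U.
Proof.
move=> UP; rewrite symZN_openE => s /UP[n nU]; exists (comm @` `I_n); split.
- by apply: finite_image; exact: finite_II.
- by move=> _ [i _ <-]; apply/commP; exists i.
- move=> _ [t st <-]; apply: nU => i ni.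
  by rewrite symZN_mul_image st//; exists i.
Qed.

End SymZNAction.

(** * Random elements *)

Section RandomSymZN.
Variables (R : realType) (disp : measure_display) (X : measurableType disp).
Variable mu : probability X R.
Implicit Types f g h : X -> borel_symZN.

Lemma measurable_symZN_open f U : measurable_fun setT f ->
  @open symZN U -> measurable (f @^-1` U).
Proof.
move=> mf oU; rewrite -[X in measurable X]setTI; apply: mf => //.
exact: sub_gen_smallest.
Qed.

Lemma measurable_symZN_image f i j : measurable_fun setT f ->
  measurable [set x | (f x : symZN) @` comm i = comm j].
Proof.
move=> mf; pose l := [:: (odflt [::] (unpickle i) : seq int,
                         odflt [::] (unpickle j) : seq int)].
rewrite (_ : [set x | _] = f @^-1` symZN_base l).
  exact: measurable_symZN_open mf (@symZN_base_open l).
apply/seteqP; split=> x; first by move=> fx p; rewrite inE => /eqP ->.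
by move=> h; exact: (h _ (mem_head _ _)).
Qed.

(** Evaluations generate the Borel structure: by [symZN_baseP] it is generated
    by the sets [symZN_base l], and sending one given set of integers onto
    another is a countable conjunction of conditions on values. *)
Lemma measurable_symZN_fun f :
  (forall n m, measurable [set x | (f x : symZN) n = m]) -> measurable_fun setT f.
Proof.
move=> mf; apply: (@measurability _ _ X borel_symZN setT f (@open symZN)); first by [].
move=> _ [U oU <-]; rewrite setTI.
pose V l := if `[< symZN_base l `<=` U >] then f @^-1` symZN_base l else set0.
rewrite (_ : _ @^-1` _ = \bigcup_l V l); last first.
  apply/seteqP; split=> [x /(symZN_baseP oU)[l fl lU]|x [l _]].
    by exists l => //; rewrite /V ifT//; exact/asboolP.
  by rewrite /V; case: ifP => // /asboolP; exact.
apply: countable_bigcupT_measurable => // l; rewrite /V; case: ifP => // _.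
have memP (B : set int) n : measurable [set x | B ((f x : symZN) n)].
  rewrite (_ : [set x | _] = \bigcup_m [set x | (f x : symZN) n = m /\ B m]).
    apply: countable_bigcupT_measurable => // m.
    have [Bm|Bm] := pselect (B m).
      by rewrite (_ : [set x | _] = [set x | (f x : symZN) n = m])//;
        apply/seteqP; split=> x => [[]|].
    by rewrite (_ : [set x | _] = set0)//; apply/seteqP; split=> x => [[]|].
  by apply/seteqP; split=> [x Bx|x [m _ [<-]]//]; exists ((f x : symZN) n).
have eqP (A B : set int) : measurable [set x | (f x : symZN) @` A = B].
  pose W n := if `[< A n >] then ~` [set x | B ((f x : symZN) n)]
              else [set x | B ((f x : symZN) n)].
  rewrite (_ : [set x | _] = ~` \bigcup_n W n).
    apply/measurableC/countable_bigcupT_measurable => // n; rewrite /W.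
    by case: ifP => _; [apply: measurableC|]; exact: memP.
  rewrite setC_bigcup; apply/seteqP; split=> [x /= fB n _|x WP].
    rewrite /W; rewrite -fB; case: ifP => /asboolP An /=; first by apply; exists n.
    by move=> [m Am /symZN_inj mn]; apply: An; rewrite -mn.
  have AB n : A n <-> B ((f x : symZN) n).
    have := WP n I; rewrite /W; case: ifP => /asboolP An /=; last by tauto.
    by move=> /contrapT.
  apply/seteqP; split=> [_ [n /AB Bn <-]//|m Bm].
  exists (((f x : symZN)^-1)%g m); last exact: symZN_invVK.
  by apply/AB; rewrite symZN_invVK.
rewrite (_ : _ @^-1` _ =
    \big[setI/setT]_(p <- l) [set x | (f x : symZN) @` CommN_of p.1 = CommN_of p.2]).
  by apply: bigsetI_measurable => p _; exact: eqP.
apply/seteqP; split=> x; rewrite -bigcap_seq.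
  by move=> h p /= pl; exact: h.
by move=> h p pl; exact: h.
Qed.

Definition moved i f g : set X :=
  [set x | (f x : symZN) @` comm i <> (g x : symZN) @` comm i].

Lemma measurable_moved i f g : measurable_fun setT f -> measurable_fun setT g ->
  measurable (moved i f g).
Proof.
move=> mf mg; rewrite -[X in measurable X]setCK; apply: measurableC.
rewrite (_ : ~` _ = \bigcup_j ([set x | (f x : symZN) @` comm i = comm j] `&`
                               [set x | (g x : symZN) @` comm i = comm j])).
  by apply: bigcupT_measurable => j; apply: measurableI; exact: measurable_symZN_image.
apply/seteqP; split=> [x /contrapT fg|x [j _ [/= fj gj]]]; last by apply; rewrite fj gj.
have [j fj] := symZN_image_comm (f x) i; exists j => //; split=> //=.
by rewrite -fg.
Qed.

Definition disagr i f g : R := pr mu (moved i f g).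

Lemma disagr_ge0 i f g : 0 <= disagr i f g.
Proof. exact: pr_ge0. Qed.

Lemma disagrxx i f : disagr i f f = 0.
Proof. by rewrite /disagr (_ : moved i f f = set0) ?pr0// -subset0 => x; apply. Qed.

Lemma disagrC i f g : disagr i f g = disagr i g f.
Proof. by congr pr; apply/seteqP; split=> x /nesym. Qed.

Lemma disagr_triangle i f g h : measurable_fun setT f -> measurable_fun setT g ->
  measurable_fun setT h -> disagr i f h <= disagr i f g + disagr i g h.
Proof.
move=> mf mg mh; apply: le_trans (prU _ _ _); try exact: measurable_moved.
apply: le_pr; [|apply: measurableU|]; try exact: measurable_moved.
move=> x fh; apply: contrapT => /not_orP[/contrapT fg /contrapT gh].
by apply: fh; rewrite fg.
Qed.

(** The points whose image of [comm i] is not among the first [J] elements of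
    [CommN]. *)
Definition escapes i f J : set X :=
  [set x | forall j, (j < J)%N -> (f x : symZN) @` comm i <> comm j].

Lemma measurable_escapes i f J : measurable_fun setT f -> measurable (escapes i f J).
Proof.
move=> mf; rewrite (_ : escapes i f J =
    \bigcap_(j < J) ~` [set x | (f x : symZN) @` comm i = comm j])//.
apply: bigcap_measurableType => j _; apply: measurableC.
exact: measurable_symZN_image.
Qed.

(** Tightness: the image of [comm i] takes countably many values. *)
Lemma escapes_small i f e : measurable_fun setT f -> 0 < e ->
  exists J, pr mu (escapes i f J) < e.
Proof.
move=> mf e0; apply: pr_decreasing_small => //.
- by move=> n; exact: measurable_escapes.
- by move=> m n mn x h j jm; apply: h; exact: leq_trans mn.
- rewrite (_ : \bigcap_n _ = set0) ?measure0// -subset0 => x h.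
  have [j fj] := symZN_image_comm (f x) i; exact: (h j.+1 I j (ltnSn j)).
Qed.

(** The usual argument by which a sequence that is Cauchy in measure has a
    subsequence converging almost everywhere, here for discrete values and for
    two sequences at once. *)
Lemma cauchy_subsequence (f g : nat -> X -> borel_symZN) :
  (forall k, measurable_fun setT (f k)) -> (forall k, measurable_fun setT (g k)) ->
  (forall n e, 0 < e -> exists N, forall k l, (N <= k)%N -> (N <= l)%N ->
    forall i, (i < n)%N -> disagr i (f k) (f l) + disagr i (g k) (g l) < e) ->
  exists2 phi : nat -> nat, forall j, (j <= phi j)%N &
    {ae mu, forall x, forall i,
      eventually_constant (fun j => (f (phi j) x : symZN) @` comm i) /\
      eventually_constant (fun j => (g (phi j) x : symZN) @` comm i)}.
Proof.
move=> mf mg fgC.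
pose b j : R := 1 / (2 ^ j.+1)%:R.
have b0 j : 0 < b j by rewrite divr_gt0// ltr0n expn_gt0.
have /choice[N_ hN] j : exists N, forall k l, (N <= k)%N -> (N <= l)%N ->
    forall i, (i < j)%N ->
      disagr i (f k) (f l) + disagr i (g k) (g l) < b j / 2 / j.+1%:R.
  by apply: fgC; rewrite !divr_gt0.
pose phi j := (\sum_(i < j.+1) N_ i + j)%N.
have phiN j : (N_ j <= phi j)%N by rewrite /phi big_ord_recr /= addnAC leq_addl.
have phiS j : (phi j <= phi j.+1)%N.
  by rewrite /phi [in leqRHS]big_ord_recr /= leq_add// leq_addr.
exists phi; first by move=> j; rewrite leq_addl.
pose C j i := moved i (f (phi j)) (f (phi j.+1)) `|` moved i (g (phi j)) (g (phi j.+1)).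
have mC j i : measurable (C j i) by apply: measurableU; exact: measurable_moved.
have := @borel_cantelli_geometric _ _ _ mu (fun j => \big[setU/set0]_(i < j) C j i).
move=> /(_ _ _)/filterS; apply.
- move=> x [n nC] i.
  have step j : (maxn n i.+1 <= j)%N -> ~ C j i x.
    rewrite geq_max => /andP[nj ij] Cx; apply: (nC j nj).
    by rewrite -bigcup_mkord; exists i.
  split; exists (maxn n i.+1) => k; elim: k => [|k IH].
  + by rewrite leqn0 => /eqP ->.
  + rewrite leq_eqVlt => /predU1P[<-//|]; rewrite ltnS => nk; rewrite -(IH nk).
    by apply: contrapT => fk; apply: (step k nk); left; exact: nesym.
  + by rewrite leqn0 => /eqP ->.
  + rewrite leq_eqVlt => /predU1P[<-//|]; rewrite ltnS => nk; rewrite -(IH nk).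
    by apply: contrapT => gk; apply: (step k nk); right; exact: nesym.
- by move=> j; exact: bigsetU_measurable.
- move=> j; apply/ltW; apply: (@pr_cover _ _ _ mu _ set0 (C j) j) => //.
  + exact: bigsetU_measurable.
  + by apply: aeW => x; rewrite -bigcup_mkord => -[i ij Ci]; right; exists i.
  + by rewrite pr0 divr_ge0// ltW// b0.
  + move=> i ij; apply: le_lt_trans (prU _ _ _) _; do ?exact: measurable_moved.
    by apply: hN => //; exact: leq_trans (phiS j).
Qed.

(** If [g] agrees with [g0] on [comm i], then [f * g] and [f0 * g0] differ
    there only if [f] and [f0] differ on [g0 @` comm i], which by tightness is
    one of finitely many sets. *)
Lemma disagr_mul_continuous f0 g0 h0 i e :
  measurable_fun setT f0 -> measurable_fun setT g0 -> measurable_fun setT h0 ->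
  {ae mu, forall x, h0 x = (f0 x * g0 x)%g :> symZN} -> 0 < e ->
  exists n, exists2 e', 0 < e' & forall f g h,
    measurable_fun setT f -> measurable_fun setT g -> measurable_fun setT h ->
    {ae mu, forall x, h x = (f x * g x)%g :> symZN} ->
    (forall j, (j < n)%N -> disagr j f0 f < e') ->
    (forall j, (j < n)%N -> disagr j g0 g < e') -> disagr i h0 h < e.
Proof.
move=> mf0 mg0 mh0 h0E e0; have e40 : 0 < e / 4 by rewrite divr_gt0.
have [J hJ] := escapes_small i mg0 e40.
exists (maxn J i.+1), (e / 4 / J.+1%:R); first by rewrite divr_gt0.
move=> f g h mf mg mh hE fP gP.
apply: (@pr_cover _ _ _ mu _ (escapes i g0 J `|` moved i g0 g)
  (fun j => moved j f0 f) J) => //.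
- exact: measurable_moved.
- by apply: measurableU; [exact: measurable_escapes|exact: measurable_moved].
- by move=> j; exact: measurable_moved.
- apply: filterS2 h0E hE => x h0x hx; rewrite /moved /= h0x hx.
  have [g0g|] := pselect ((g0 x : symZN) @` comm i = (g x : symZN) @` comm i);
    last by left; right.
  have [|/existsNP[j /not_implyP[jJ /contrapT gj]]] := pselect (escapes i g0 J x).
    by left; left.
  move=> fg; right; exists j => // fj; apply: fg.
  by rewrite !symZN_mul_image -g0g gj.
- apply: le_trans (prU _ _ _) _.
    exact: measurable_escapes.
    exact: measurable_moved.
  rewrite [leRHS](_ : _ = e / 4 + e / 4); last by lra.
  rewrite lerD ?(ltW hJ)// (le_trans (ltW (gP i (leq_maxr _ _))))//.
  by rewrite ler_piMr ?(ltW e40)// invf_le1// ler1n.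
- move=> j jJ; apply: lt_le_trans (fP j _) _; first by rewrite leq_max jJ.
  by rewrite ler_pM2r// ler_pM2l// lef_pV2 ?posrE// ler_nat.
Qed.

(** The inverses differ on [comm i] only if [f] and [f0] differ on the image of
    [comm i] by the inverse of [f0], again one of finitely many sets. *)
Lemma disagr_inv_continuous f0 h0 i e :
  measurable_fun setT f0 -> measurable_fun setT h0 ->
  {ae mu, forall x, h0 x = (f0 x)^-1%g :> symZN} -> 0 < e ->
  exists n, exists2 e', 0 < e' & forall f h,
    measurable_fun setT f -> measurable_fun setT h ->
    {ae mu, forall x, h x = (f x)^-1%g :> symZN} ->
    (forall j, (j < n)%N -> disagr j f0 f < e') -> disagr i h0 h < e.
Proof.
move=> mf0 mh0 h0E e0; have e20 : 0 < e / 2 by rewrite divr_gt0.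
have [J hJ] := escapes_small i mh0 e20.
exists J, (e / 2 / J.+1%:R); first by rewrite divr_gt0.
move=> f h mf mh hE fP.
apply: (@pr_cover _ _ _ mu _ (escapes i h0 J) (fun j => moved j f0 f) J) => //.
- exact: measurable_moved.
- exact: measurable_escapes.
- by move=> j; exact: measurable_moved.
- apply: filterS2 h0E hE => x h0x hx.
  have [|/existsNP[j /not_implyP[jJ /contrapT hj]]] := pselect (escapes i h0 J x).
    by left.
  move=> hh; right; exists j => // fj; apply: hh.
  have f0j : (f0 x : symZN) @` comm j = comm i by apply/symZN_image_inv; rewrite -h0x.
  by rewrite hj hx; apply/esym/symZN_image_inv; rewrite -fj.
- exact: ltW.
Qed.

Variable d : symZN_metric R.

Lemma lt_probability_setC A (e : R) : measurable A ->
  ((1 - e)%:E < mu A)%E = (pr mu (~` A) < e).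
Proof.
move=> mA; have := probability_setC mu mA.
rewrite (prE mu mA) (prE mu (measurableC mA)) -EFinB => -[->].
by rewrite lte_fin ltrBlDr addrC -ltrBlDr.
Qed.

(** The sets [E n], of the permutations around which agreement below [n] forces
    a small distance, are open and increase to the whole group; since [f] takes
    its values in [E n] with probability close to 1, the pointwise comparison
    of the two topologies becomes uniform. *)
Lemma disagr_small_dist f e : measurable_fun setT f -> 0 < e ->
  exists n, exists2 e', 0 < e' & forall g, measurable_fun setT g ->
    (forall i, (i < n)%N -> disagr i f g < e') ->
    ((1 - e)%:E < mu [set x | d (f x) (g x) < e]%R)%E.
Proof.
move=> mf e0; have e20 : 0 < e / 2 by rewrite divr_gt0.
have [[d0 d00 dC dT] dE] := symZN_metric_compatible d.
pose E n : set symZN := [set s | forall t t', agree_below n s t -> agree_below n s t' ->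
  d t t' < e].
have oE n : open (E n).
  apply: agree_symZN_open => s Es; exists n => u su t t' ut ut'.
  by apply: Es => i ni; rewrite (su _ ni); (exact: ut || exact: ut').
have mE n : measurable (f @^-1` (~` E n)).
  by rewrite -preimage_setC; apply/measurableC/measurable_symZN_open.
have [m n mn x nE En||n nE] := @pr_decreasing_small _ _ _ mu
    (fun n => f @^-1` (~` E n)) _ e20 mE.
- apply: nE => t t' ft ft'; apply: En => i im; [apply: ft|apply: ft'];
    exact: leq_trans mn.
- rewrite (_ : \bigcap_n _ = set0) ?measure0// -subset0 => x nE.
  have [||n fn] := @symZN_open_agree [set t | d (f x) t < e / 2] (f x).
  + exact: symZN_ball_open.
  + by rewrite /= ((d00 (f x) (f x)).2 erefl).
  + apply: (nE n I) => t t' /fn /= ft /fn /= ft'.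
    by rewrite (le_lt_trans (dT _ (f x) _))// (splitr e) ltrD// dC.
exists n, (e / 2 / n.+1%:R); first by rewrite divr_gt0.
move=> g mg fg; rewrite lt_probability_setC; last exact: measurable_symZN_dist.
apply: (@pr_cover _ _ _ mu _ (f @^-1` (~` E n)) (fun i => moved i f g) n) => //.
- by apply: measurableC; exact: measurable_symZN_dist.
- by move=> j; exact: measurable_moved.
- apply: aeW => x /= fgx; apply: contrapT => /not_orP[/contrapT En].
  move=> /forall2NP h; apply: fgx; apply: En => // i ni.
  by apply: contrapT => fgi; have [] := h i.
- exact: ltW.
Qed.

(** Conversely, the sets [V n] of the permutations around which a distance at
    most [n.+1%:R^-1] forces agreement on [comm i] are open and increase to the
    whole group. *)
Lemma dist_small_disagr f i e : measurable_fun setT f -> 0 < e ->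
  exists2 e', 0 < e' & forall g, measurable_fun setT g ->
    ((1 - e')%:E < mu [set x | d (f x) (g x) < e']%R)%E -> disagr i f g < e.
Proof.
move=> mf e0; have e20 : 0 < e / 2 by rewrite divr_gt0.
have [[d0 d00 dC dT] dE] := symZN_metric_compatible d.
pose V n : set symZN := [set s | exists2 r : R, n.+1%:R^-1 < r &
  forall t, d s t < r -> s @` comm i = t @` comm i].
have oV n : open (V n).
  have : (0 : R) < n.+1%:R^-1 by rewrite invr_gt0.
  rewrite dE /V; move: (_^-1) => c c0 s [r nr sr]; exists ((r - c) / 2).
    by rewrite divr_gt0// subr_gt0.
  move=> u /= su; exists (r - d s u); first by lra.
  move=> t ut; rewrite -(sr u); last by have := d0 u t; lra.
  by apply: sr; have := dT s u t; lra.
have mV n : measurable (f @^-1` (~` V n)).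
  by rewrite -preimage_setC; apply/measurableC/measurable_symZN_open.
have [m n mn x nV [r mr fr]||n nV] := @pr_decreasing_small _ _ _ mu
    (fun n => f @^-1` (~` V n)) _ e20 mV.
- apply: nV; exists r => //; apply: le_lt_trans mr.
  by rewrite lef_pV2 ?posrE// ler_nat.
- rewrite (_ : \bigcap_n _ = set0) ?measure0// -subset0 => x nV.
  have : open [set t : symZN | (f x : symZN) @` comm i = t @` comm i].
    apply: agree_symZN_open => s fs; exists i.+1 => t st.
    by rewrite /= fs; exact: st.
  rewrite dE => /(_ (f x) erefl)[r r0 fr].
  have [n nr] := exists_invSn_lt r0.
  by apply: (nV n I); exists r.
exists (Num.min (e / 2) n.+1%:R^-1); first by rewrite lt_min e20 invr_gt0 ltr0n.
move=> g mg; set e' := Num.min _ _; have mfg r : measurable [set x | d (f x) (g x) < r].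
  exact: measurable_symZN_dist.
rewrite lt_probability_setC// => fg.
apply: (@le_lt_trans _ _
  (pr mu (f @^-1` (~` V n) `|` ~` [set x | d (f x) (g x) < e']))).
  apply: le_pr; [exact: measurable_moved|apply: measurableU => //; exact: measurableC|].
  move=> x fgx; apply: contrapT => /not_orP[/contrapT[r nr fr] /contrapT /= fge].
  apply/fgx/fr; apply: lt_trans nr; apply: lt_le_trans fge _.
  by rewrite ge_min lexx orbT.
apply: le_lt_trans (prU _ (mV n) (measurableC (mfg _))) _.
rewrite (splitr e) ltrD//; apply: lt_le_trans fg _.
by rewrite ge_min lexx.
Qed.

End RandomSymZN.

(** * Iterates and orbits *)

Section Iterz.
Variables (X : Type) (f : X -> X).
Hypothesis fb : bijective f.

Lemma iterz_addr1 n x : iterz f (n + 1) x = f (iterz f n x).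
Proof.
case: n => [k|[|k]].
- by rewrite (_ : Posz k + 1 = Posz k.+1)//; lia.
- by rewrite /= bij_invVK.
- by rewrite (_ : Negz k.+1 + 1 = Negz k) /= ?bij_invVK//; lia.
Qed.

Lemma iterzD n m x : iterz f (n + m) x = iterz f n (iterz f m x).
Proof.
elim/int_ind: n => [|n IH|n IH]; first by rewrite add0r.
  by rewrite -addn1 PoszD addrAC !iterz_addr1 IH.
have nE : - n.+1%:Z + 1 = - n%:Z by lia.
by apply: (bij_inj fb); rewrite -!iterz_addr1 addrAC nE.
Qed.

Definition free_at x := forall n, iterz f n x = x -> n = 0.

Lemma free_at_inj x n m : free_at x -> iterz f n x = iterz f m x -> n = m.
Proof.
move=> fx nm; apply/eqP; rewrite -subr_eq0; apply/eqP/fx.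
by rewrite addrC iterzD nm -iterzD addNr.
Qed.

(** A nonzero period [n] would leave at most [`|n|] points in the orbit. *)
Lemma infinite_orbit_free x : infinite_set (range (fun n => iterz f n x)) -> free_at x.
Proof.
move=> infx n nx; apply: contrapT => /eqP n0; apply: infx.
have qx (q : int) : iterz f (q * n) x = x.
  elim/int_ind: q => [|q IH|q IH]; first by rewrite mul0r.
    by rewrite -addn1 PoszD mulrDl mul1r iterzD nx.
  rewrite -[in RHS]IH (_ : - q%:Z * n = n + - q.+1%:Z * n); last by lia.
  by rewrite addrC iterzD nx.
apply: (@sub_finite_set _ _ ((fun k : nat => iterz f k x) @` `I_(`|n|%N))).
  move=> _ [m _ <-]; exists `|(m %% n)%Z|%N.
    by rewrite /= -ltz_nat gez0_abs ?modz_ge0// ltz_mod.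
  by rewrite gez0_abs ?modz_ge0// [in RHS](divz_eq m n) (addrC (_ * _)) [RHS]iterzD qx.
by apply: finite_image; exact: finite_II.
Qed.

(** This relation replaces the cocycle in what follows: it is compatible with
    composition and inversion without any hypothesis on [x], and at a point
    with free orbit it characterizes [Phi T S x] ([acts_on_orbit_Phi]). *)
Definition acts_on_orbit (S : X -> X) (x : X) (s : int -> int) :=
  forall n, S (iterz f n x) = iterz f (s n) x.

Lemma acts_on_orbit_comp S S' x s s' :
  acts_on_orbit S x s -> acts_on_orbit S' x s' -> acts_on_orbit (S \o S') x (s \o s').
Proof. by move=> Ss Ss' n; rewrite /= Ss' Ss. Qed.

Lemma acts_on_orbit_inv S x (s : symZN) : bijective S ->
  acts_on_orbit S x s -> acts_on_orbit (bij_inv S) x (s^-1)%g.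
Proof.
move=> Sb Ss n; apply: (bij_inj Sb).
by rewrite bij_invVK// Ss symZN_invVK.
Qed.

Lemma acts_on_orbit_unique S x (s t : symZN) : free_at x ->
  acts_on_orbit S x s -> acts_on_orbit S x t -> s = t.
Proof.
move=> fx Ss St; apply/val_inj/funext => n /=.
by apply: (free_at_inj fx); rewrite -Ss -St.
Qed.

End Iterz.

Section Orbits.
Variables (R : realType) (disp : measure_display) (X : measurableType disp).
Variables (mu : probability X R).
Hypothesis sX : standard_borel R X.
Implicit Types f g S T : preAut mu.

Lemma preAut_bij f : bijective f.
Proof. by case: (preAutP f). Qed.

Lemma preAut_measurable f : measurable_fun setT f.
Proof. by case: (preAutP f). Qed.

(** The inverse is Borel by the Lusin-Souslin theorem. *)
Lemma is_aut_inv f : is_aut mu (bij_inv f).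
Proof.
have [fb mf nf] := preAutP f.
have preE A : bij_inv f @^-1` A = f @` A.
  apply/seteqP; split=> [x Ax|_ [x Ax <-]]; last by rewrite /= bij_invK.
  by exists (bij_inv f x) => //; exact: bij_invVK.
have mfV : measurable_fun setT (bij_inv f).
  by move=> _ A mA; rewrite setTI preE; exact: (measurable_bij_image sX).
split=> //; first by exists f; [exact: bij_invVK|exact: bij_invK].
move=> A mA; rewrite -(nf (bij_inv f @^-1` A)).
  rewrite /pushforward preE (_ : f @^-1` _ = A)//.
  by apply/seteqP; split=> [x [y Ay /(bij_inj fb) <-]//|x Ax]; exists x.
by rewrite preE; exact: (measurable_bij_image sX).
Qed.

Definition preAut_inv f : preAut mu := PreAut (asboolT (is_aut_inv f)).

Lemma is_aut_iter f k : is_aut mu (iter k f).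
Proof.
elim: k => [|k IH]; first exact: is_aut_id.
exact: (is_aut_comp f (PreAut (asboolT IH))).
Qed.

Lemma is_aut_iterz T n : is_aut mu (iterz T n).
Proof. by case: n => k; [exact: is_aut_iter|exact: (is_aut_iter (preAut_inv T))]. Qed.

Lemma measurable_iterz T n : measurable_fun setT (iterz T n).
Proof. by case: (is_aut_iterz T n). Qed.

Lemma ae_comp (g : X -> X) (P : X -> Prop) : is_aut mu g ->
  {ae mu, forall x, P x} -> {ae mu, forall x, P (g x)}.
Proof.
move=> [_ mg ng] [A [mA A0 PA]]; exists (g @^-1` A); split.
- by rewrite -[X in measurable X]setTI; exact: mg.
- exact/ng.
- by move=> x /PA.
Qed.

Lemma ae_forall_int (P : int -> X -> Prop) :
  (forall n, {ae mu, forall x, P n x}) -> {ae mu, forall x n, P n x}.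
Proof.
move=> Pn; have := @ae_foralln _ _ _ mu
  (fun k x => if unpickle k is Some n then P n x else True).
move=> /(_ _)/filterS; apply.
  by move=> x h n; have := h (pickle n); rewrite pickleK.
by move=> k; case: unpickle => [n|]; [exact: Pn|exact: aeW].
Qed.

Lemma ae_orbit T (P : X -> Prop) :
  {ae mu, forall x, P x} -> {ae mu, forall x n, P (iterz T n x)}.
Proof.
by move=> Px; apply: ae_forall_int => n; apply: ae_comp => //; exact: is_aut_iterz.
Qed.

Variable T : preAut mu.
Hypothesis aT : aperiodic T.

Lemma ae_free : {ae mu, forall x, free_at T x}.
Proof. by apply: filterS aT => x; apply: infinite_orbit_free; exact: preAut_bij. Qed.

Lemma acts_on_orbit_Phi S x (s : symZN) : free_at T x ->
  acts_on_orbit T S x s -> Phi T S x = s.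
Proof.
have TD := iterzD (preAut_bij T); move=> fx Ss; apply/funext => n.
rewrite /Phi /cocycle; case: xgetP => [k _ /= kP|/(_ (s n - n)) []] /=.
  apply: (free_at_inj (preAut_bij T) fx).
  by rewrite -Ss kP -TD addrC.
by rewrite Ss -TD subrK.
Qed.

Lemma com_full_groupP (S : Aut mu) : com_full_group T S <->
  {ae mu, forall x, exists s : symZN, acts_on_orbit T (repr S) x s}.
Proof.
have TD := iterzD (preAut_bij T); split=> [[fS cS]|cS].
  move: (ae_orbit T fS) cS; apply: filterS2 => x fx cx.
  exists (SymZN (asboolT cx)) => n /=; rewrite /Phi addrC TD /cocycle.
  by case: xgetP => [k _ //|h]; have [k /h] := fx n.
split; first by apply: filterS cS => x [s /(_ 0)/= Ss]; exists (s 0).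
move: ae_free cS; apply: filterS2 => x fx [s /(acts_on_orbit_Phi fx) ->].
exact: symZNP.
Qed.

Lemma com_full_group_Aut_of f : com_full_group T (Aut_of f) <->
  {ae mu, forall x, exists s : symZN, acts_on_orbit T f x s}.
Proof.
have fE := ae_orbit T (repr_Aut_of f).
rewrite com_full_groupP; split; move: fE; apply: filterS2 => x fE [s Ss].
  by exists s => n; rewrite -fE.
by exists s => n; rewrite fE.
Qed.

Section Class.
Variable d : symZN_metric R.

Lemma measurable_L0_fun (F : L0 mu d) :
  measurable_fun setT (L0_fun F : X -> borel_symZN).
Proof. exact: measurable_funPT. Qed.

Lemma L0_of_measurable (phi : X -> borel_symZN) : measurable_fun setT phi ->
  exists F : L0 mu d, {ae mu, forall x, L0_fun F x = phi x :> symZN}.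
Proof.
move=> mphi; pose f := mfun_Sub (mem_set mphi) : {mfun X >-> borel_symZN}.
exists (\pi_{mfun_ mu, X >-> borel_symZN}%qT f).
have : (repr (\pi_{mfun_ mu, X >-> borel_symZN}%qT f) == f
  %[mod {mfun_ mu, X >-> borel_symZN}])%qT by rewrite reprK.
rewrite eqmodE => /asboolP; apply: filterS => x /(_ I); exact.
Qed.

(** The class [Phi_L0 d T S] is not its dummy value: off a measurable null set
    [N] the orbit is free and [Phi T (repr S)] is a commensurating permutation,
    which depends measurably on the point since its value at [n] is [m] exactly
    when [S (T^n x) = T^m x]. *)
Lemma Phi_L0_orbit (S : Aut mu) : com_full_group T S ->
  {ae mu, forall x, acts_on_orbit T (repr S) x (L0_fun (Phi_L0 d T S) x)}.
Proof.
move=> /com_full_groupP cS.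
have [N [mN N0 NP]] : {ae mu, forall x, free_at T x /\
    exists s : symZN, acts_on_orbit T (repr S) x s}.
  by move: ae_free cS; apply: filterS2 => x ? ?.
have {}NP x : ~ N x -> free_at T x /\
    exists s : symZN, acts_on_orbit T (repr S) x s.
  by move=> Nx; apply: contrapT => h; apply/Nx/NP.
pose phi x : symZN := if `[< N x >] then 1%g
  else xget 1%g [set s : symZN | acts_on_orbit T (repr S) x s].
have phiP x : ~ N x -> acts_on_orbit T (repr S) x (phi x).
  move=> Nx; rewrite /phi ifF; last exact/asboolP.
  have [_] := NP x Nx; exact: (@xgetPex _ 1%g [set s : symZN | _]).
have mphi : measurable_fun setT (phi : X -> borel_symZN).
  apply: measurable_symZN_fun => n m.
  rewrite (_ : [set x | _] = (N `&` [set x | n = m]) `|`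
    (~` N `&` [set x | (repr S \o iterz T n) x = iterz T m x])).
    apply: measurableU; apply: measurableI => //.
    - have [->|nm] := pselect (n = m).
        by rewrite (_ : [set _ | _] = setT)//; apply/seteqP; split.
      by rewrite (_ : [set _ | _] = set0)//; apply/seteqP; split.
    - exact: measurableC.
    - apply: (measurable_eq_fun sX); last exact: measurable_iterz.
      by apply: measurableT_comp; [exact: preAut_measurable|exact: measurable_iterz].
  apply/seteqP; split=> x.
    move=> /= xnm; have [Nx|Nx] := pselect (N x); [left|right]; split=> //.
      by move: xnm; rewrite /phi ifT//; exact/asboolP.
    by rewrite /= phiP// xnm.
  move=> [[Nx /= nm]|[Nx /= Snm]]; first by rewrite /phi ifT//; exact/asboolP.
  have [fx _] := NP x Nx; apply: (free_at_inj (preAut_bij T) fx).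
  by rewrite -phiP.
have NC : {ae mu, forall x, ~ N x} by exists N; split=> // x /contrapT.
have [F FE] := L0_of_measurable mphi.
have : {ae mu, forall x, L0_fun (Phi_L0 d T S) x = Phi T (repr S) x :> (int -> int)}.
  apply: (@xgetPex _ (L0_one mu d) [set F : L0 mu d |
    {ae mu, forall x, L0_fun F x = Phi T (repr S) x :> (int -> int)}]).
  exists F => /=; move: NC FE; apply: filterS2 => x Nx ->.
  by have [fx _] := NP x Nx; rewrite (acts_on_orbit_Phi fx (phiP x Nx)).
move: NC; apply: filterS2 => x Nx; have [fx _] := NP x Nx.
rewrite (acts_on_orbit_Phi fx (phiP x Nx)) => PE n.
by rewrite (phiP x Nx) PE.
Qed.

End Class.
End Orbits.

(** * The topology of the commensurating full group *)

(** Finitely many conditions, each of which holds on a small enough basic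
    neighbourhood, hold on a common one. *)
Lemma basis_forall_below (R : realType) (Z : Type) (B : nat -> R -> Z -> Prop)
    (Q : nat -> Z -> Prop) N :
  (forall m n e e' z, (m <= n)%N -> 0 < e' -> e' <= e -> B n e' z -> B m e z) ->
  (forall i, exists n, exists2 e, 0 < e & forall z, B n e z -> Q i z) ->
  exists n, exists2 e, 0 < e & forall z, B n e z -> forall i, (i < N)%N -> Q i z.
Proof.
move=> BW BQ; elim: N => [|N [n [e e0 h]]]; first by exists 0%N, 1.
have [n' [e' e'0 h']] := BQ N.
have me : 0 < Num.min e e' by rewrite lt_min e0.
exists (maxn n n'), (Num.min e e') => // z zB i.
rewrite ltnS leq_eqVlt => /predU1P[->|iN].
  by apply/h'/(BW _ _ _ _ _ _ me _ zB); rewrite ?leq_maxr// ge_min lexx orbT.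
by apply: h iN; apply: (BW _ _ _ _ _ _ me _ zB); rewrite ?leq_maxl// ge_min lexx.
Qed.

Section L0Balls.
Variables (R : realType) (disp : measure_display) (X : measurableType disp).
Variables (mu : probability X R) (d : symZN_metric R).
Implicit Types f g h : L0 mu d.

Let measurable_close f g e : measurable [set x | d (L0_fun f x) (L0_fun g x) < e].
Proof. by apply: measurable_symZN_dist; exact: measurable_L0_fun. Qed.

Lemma L0_ballE f g e :
  L0_ball f e g <-> pr mu (~` [set x | d (L0_fun f x) (L0_fun g x) < e]) < e.
Proof. by rewrite /L0_ball /= lt_probability_setC. Qed.

Lemma L0_ball_widen f g e e' : e <= e' -> L0_ball f e g -> L0_ball f e' g.
Proof.
move=> ee'; rewrite !L0_ballE => fg; apply: (lt_le_trans _ ee').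
apply: le_lt_trans fg; apply: le_pr; do ?exact: measurableC.
by move=> x; apply: contra_not => /= fgx; exact: lt_le_trans ee'.
Qed.

Lemma L0_ball_split f g h e :
  L0_ball f (e / 2) g -> L0_ball g (e / 2) h -> L0_ball f e h.
Proof.
have [[_ _ _ dT] _] := symZN_metric_compatible d.
rewrite !L0_ballE => fg gh; rewrite (splitr e); apply: le_lt_trans (ltrD fg gh).
apply: le_trans (prU _ _ _); do ?exact: measurableC.
apply: le_pr; [|apply: measurableU|]; do ?exact: measurableC.
rewrite -setCI; move=> x; apply: contra_not => -[/= fgx ghx].
exact: le_lt_trans (dT _ _ _) (ltrD fgx ghx).
Qed.

Lemma L0_ball_center f e : 0 < e -> L0_ball f e f.
Proof.
have [[_ d00 _ _] _] := symZN_metric_compatible d.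
move=> e0; rewrite L0_ballE (_ : ~` _ = set0) ?pr0// -subset0 => x /=.
by rewrite ((d00 _ _).2 erefl).
Qed.

End L0Balls.

Section ComFullGroup.
Variables (R : realType) (disp : measure_display) (X : measurableType disp).
Variables (mu : probability X R) (T : preAut mu) (d : symZN_metric R).
Hypotheses (sX : standard_borel R X) (aT : aperiodic T).

Local Notation G := (ComFullGroup d T).
Implicit Types S L : G.

Lemma com_valP S : com_full_group T (com_val S).
Proof. exact: set_mem (valP (S : com_full_group T)). Qed.

Definition com_of (S : Aut mu) (cS : com_full_group T S) : G :=
  exist _ S (mem_set cS).

Lemma com_ofK (S : Aut mu) (cS : com_full_group T S) : com_val (com_of cS) = S.
Proof. by []. Qed.

Lemma com_val_inj : injective (@com_val R disp X mu d T).
Proof. exact: val_inj. Qed.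

Definition coords S : X -> borel_symZN := L0_fun (Phi_L0 d T (com_val S)).

Lemma measurable_coords S : measurable_fun setT (coords S).
Proof. exact: measurable_L0_fun. Qed.

Lemma coords_acts S :
  {ae mu, forall x, acts_on_orbit T (repr (com_val S)) x (coords S x : symZN)}.
Proof. exact (Phi_L0_orbit sX aT d (com_valP S)). Qed.

Lemma coords_unique S (f : preAut mu) (s : X -> symZN) : com_val S = Aut_of f ->
  {ae mu, forall x, acts_on_orbit T f x (s x)} ->
  {ae mu, forall x, coords S x = s x :> symZN}.
Proof.
move=> Sf fs; have : {ae mu, forall x, free_at T x /\
    forall n, repr (Aut_of f) (iterz T n x) = f (iterz T n x)}.
  move: (ae_free aT) (ae_orbit sX T (repr_Aut_of f)).
  by apply: filterS2 => x ? ?.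
move: (coords_acts S) fs; rewrite Sf.
apply: filterS3 => x Ss fsx [fx fE]; apply: (acts_on_orbit_unique (preAut_bij T) fx Ss).
by move=> n; rewrite fE fsx.
Qed.

Lemma coords_inj S L : {ae mu, forall x, coords S x = coords L x :> symZN} -> S = L.
Proof.
move=> SL; apply: com_val_inj; rewrite -(reprK (com_val S)) -(reprK (com_val L)).
apply/Aut_ofP; move: SL (coords_acts S) (coords_acts L).
by apply: filterS3 => x SL /(_ 0)/= Sx /(_ 0)/= Lx; rewrite Sx SL.
Qed.

Lemma com_full_group_mul S L :
  com_full_group T (com_val S * com_val L)%g.
Proof.
apply/(com_full_group_Aut_of sX aT); move: (coords_acts S) (coords_acts L).
apply: filterS2 => x Sx Lx; exists ((coords S x : symZN) * (coords L x : symZN))%g.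
exact: acts_on_orbit_comp Sx Lx.
Qed.

Lemma com_full_group_one : com_full_group T (Aut_one mu).
Proof. by apply/(com_full_group_Aut_of sX aT)/aeW => x; exists 1%g. Qed.

Definition Aut_inv (S : Aut mu) : Aut mu := Aut_of (preAut_inv sX (repr S)).

Lemma com_full_group_inv S : com_full_group T (Aut_inv (com_val S)).
Proof.
apply/(com_full_group_Aut_of sX aT); apply: filterS (coords_acts S) => x Sx.
exists (coords S x : symZN)^-1%g.
exact: acts_on_orbit_inv (preAut_bij _) Sx.
Qed.

Definition com_mul S L : G := com_of (com_full_group_mul S L).
Definition com_one : G := com_of com_full_group_one.
Definition com_inv S : G := com_of (com_full_group_inv S).

Lemma coords_mul S L :
  {ae mu, forall x, coords (com_mul S L) x =
    ((coords S x : symZN) * (coords L x : symZN))%g :> symZN}.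
Proof.
apply: (coords_unique (f := preAut_mul (repr (com_val S)) (repr (com_val L)))) => //.
move: (coords_acts S) (coords_acts L); apply: filterS2 => x.
exact: acts_on_orbit_comp.
Qed.

Lemma coords_inv S :
  {ae mu, forall x, coords (com_inv S) x = (coords S x : symZN)^-1%g :> symZN}.
Proof.
apply: (coords_unique (f := preAut_inv sX (repr (com_val S)))) => //.
apply: filterS (coords_acts S) => x; exact: acts_on_orbit_inv (preAut_bij _).
Qed.

Lemma com_mulA : associative com_mul.
Proof. by move=> S1 S2 S3; apply: com_val_inj; exact: Aut_mulA. Qed.

Lemma com_mul1 : left_id com_one com_mul.
Proof. by move=> S; apply: com_val_inj; exact: Aut_mul1. Qed.

Lemma com_mulV : left_inverse com_one com_inv com_mul.
Proof.
move=> S; apply: com_val_inj; rewrite !com_ofK.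
rewrite -[X in (_ * X)%g](reprK (com_val S)).
apply: etrans (Aut_of_comp _ _) _; congr Aut_of; apply/val_inj/funext => x /=.
exact/bij_invK/preAut_bij.
Qed.

Lemma com_mul_val S L : com_val (com_mul S L) = (com_val S * com_val L)%g.
Proof. by []. Qed.

Definition com_ball S n (e : R) : set G :=
  [set L | forall i, (i < n)%N -> disagr mu i (coords S) (coords L) < e].

Lemma com_ball_widen S m n e e' : (m <= n)%N -> e' <= e ->
  com_ball S n e' `<=` com_ball S m e.
Proof.
by move=> mn ee' L SL i im; apply: lt_le_trans ee'; apply: SL; exact: leq_trans mn.
Qed.

Lemma com_ball_center S n e : 0 < e -> com_ball S n e S.
Proof. by move=> e0 i _; rewrite disagrxx. Qed.

(** The identification of the topology: by the comparison of the distance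
    [d] with the action on [CommN], the sets [com_ball] form a neighbourhood
    basis, whichever compatible metric [d] is used. *)
Lemma com_openP (U : set G) : open U <->
  forall S, U S -> exists n, exists2 e, 0 < e & com_ball S n e `<=` U.
Proof.
rewrite ComFullGroup_openE L0_openE; split=> [[V oV <-] S VS|UP].
  have [e e0 eV] := oV _ VS.
  have [n [e' e'0 h]] := disagr_small_dist mu d (measurable_coords S) e0.
  exists n, e' => // L SL; apply: eV; apply: h => //; exact: measurable_coords.
(* An open set of [L0] that induces [U]. *)
exists [set g : L0 mu d | exists2 e, 0 < e & forall L,
    L0_ball g e (Phi_L0 d T (com_val L)) -> U L].
  move=> g [e e0 gU]; have e20 : 0 < e / 2 by rewrite divr_gt0.
  exists (e / 2) => // g' gg'; exists (e / 2) => // L g'L; apply: gU.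
  exact: L0_ball_split gg' g'L.
apply/seteqP; split=> [S [e e0]|S US] /=; first by apply; exact: L0_ball_center.
have [n [e e0 nU]] := UP S US.
pose B (_ : nat) e L :=
  L0_ball (Phi_L0 d T (com_val (S : G))) e (Phi_L0 d T (com_val L)).
have [||m [e' e'0 h]] := @basis_forall_below R G B
    (fun i L => disagr mu i (coords S) (coords L) < e) n.
- by move=> m1 m2 e1 e2 L _ _ e21; exact: L0_ball_widen.
- move=> i; have [e' e'0 h] := dist_small_disagr mu d i (measurable_coords S) e0.
  exists 0%N, e' => // L SL; apply: h => //; exact: measurable_coords.
- by exists e' => // L /h/nU.
Qed.

Lemma com_ball_open S n e : open (com_ball S n e).
Proof.
apply/com_openP => L SL.
have [||m [e' e'0 h]] := @basis_forall_below R G (com_ball L)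
    (fun i L' => (i < n)%N -> disagr mu i (coords S) (coords L') < e) n.
- by move=> m1 m2 e1 e2 L' m12 _ e12; exact: com_ball_widen m12 e12 _.
- move=> i; have [iN|iN] := ltnP i n; last first.
    by exists 0%N, 1 => // L' _; rewrite ltnNge iN.
  exists i.+1, (e - disagr mu i (coords S) (coords L)); first by rewrite subr_gt0 SL.
  move=> L' /(_ i (ltnSn i)) LL' _.
  apply: le_lt_trans (disagr_triangle mu i (measurable_coords S)
    (measurable_coords L) (measurable_coords L')) _.
  by rewrite -ltrBrDl.
- by exists m, e' => // L' /h hL' i iN; exact: hL'.
Qed.

Lemma com_ball_nbhs S n e : 0 < e -> nbhs S (com_ball S n e).
Proof.
move=> e0; apply: open_nbhs_nbhs; split; first exact: com_ball_open.
exact: com_ball_center.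
Qed.

Lemma com_mul_basis S L n e : 0 < e -> exists m, exists2 e', 0 < e' &
  forall S' L', com_ball S m e' S' -> com_ball L m e' L' ->
    com_ball (com_mul S L) n e (com_mul S' L').
Proof.
move=> e0.
pose B n e (p : G * G) := com_ball S n e p.1 /\ com_ball L n e p.2.
have [||m [e' e'0 h]] := @basis_forall_below R (G * G) B
    (fun i p => disagr mu i (coords (com_mul S L)) (coords (com_mul p.1 p.2)) < e) n.
- by move=> m1 m2 e1 e2 p m12 _ e12 [Sp Lp]; split; apply: com_ball_widen m12 e12 _ _.
- move=> i; have [m [e' e'0 h]] := disagr_mul_continuous i (measurable_coords S)
    (measurable_coords L) (measurable_coords _) (coords_mul S L) e0.
  exists m, e' => // -[S' L'] /= [SS' LL']; apply: h SS' LL';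
    [exact: measurable_coords..|exact: coords_mul].
- by exists m, e' => // S' L' SS' LL'; exact: (h (S', L')).
Qed.

Lemma com_inv_basis S n e : 0 < e -> exists m, exists2 e', 0 < e' &
  forall L, com_ball S m e' L -> com_ball (com_inv S) n e (com_inv L).
Proof.
move=> e0; have [||m [e' e'0 h]] := @basis_forall_below R G (com_ball S)
    (fun i L => disagr mu i (coords (com_inv S)) (coords (com_inv L)) < e) n.
- by move=> m1 m2 e1 e2 L' m12 _ e12; exact: com_ball_widen m12 e12 _.
- move=> i; have [m [e' e'0 h]] := disagr_inv_continuous i (measurable_coords S)
    (measurable_coords _) (coords_inv S) e0.
  exists m, e' => // L SL; apply: h SL; [exact: measurable_coords..|exact: coords_inv].
- by exists m, e' => // L /h.
Qed.

Lemma com_mul_continuous : continuous (fun p : G * G => com_mul p.1 p.2).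
Proof.
move=> [S L] A /=; rewrite nbhsE /= => -[U [oU US] UA].
have [n [e e0 nU]] := (com_openP U).1 oU _ US.
have [m [e' e'0 h]] := com_mul_basis S L n e0.
exists (com_ball S m e', com_ball L m e'); first by split; exact: com_ball_nbhs.
by move=> [S' L'] [/= SS' LL']; apply/UA/nU; exact: h.
Qed.

Lemma com_inv_continuous : continuous com_inv.
Proof.
move=> S A /=; rewrite nbhsE /= => -[U [oU US] UA].
have [n [e e0 nU]] := (com_openP U).1 oU _ US.
have [m [e' e'0 h]] := com_inv_basis S n e0.
apply: filterS (com_ball_nbhs S m e'0) => L /h SL; exact/UA/nU.
Qed.

(** * Separability and completeness *)

(** Two elements with the same [code] at stage [k] have, for all [i] and [j]
    below [k], nearly the same sets [piece _ i j]; by tightness they are close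
    to each other. So one element for each code that occurs forms a dense
    set, without any description of the limits of such codes. *)
Lemma com_separable : separable_space G.
Proof.
have [A [mA denseA]] := measure_algebra_separable mu sX.
pose piece S i j := [set x | (coords S x : symZN) @` comm i = comm j].
have mpiece S i j : measurable (piece S i j).
  exact: measurable_symZN_image (measurable_coords S).
have /choice[a aP] (c : G * nat * nat * nat) : exists m,
    pr mu (piece c.1.1.1 c.1.2 c.2 `+` A m) < c.1.1.2.+1%:R^-1.
  by apply: denseA; rewrite ?invr_gt0.
pose code S k := (k, [seq [seq a (S, k, i, j) | j <- iota 0 k] | i <- iota 0 k]).
have codeP S L k i j : code S k = code L k -> (i < k)%N -> (j < k)%N ->
    a (S, k, i, j) = a (L, k, i, j).
  move=> [/eq_in_map SL] ik jk.
  have /SL/eq_in_map : i \in iota 0 k by rewrite mem_iota.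
  by apply; rewrite mem_iota.
have /choice[pick pickP] (c : nat * seq (seq nat)) :
    exists S, (exists L, code L c.1 = c) -> code S c.1 = c.
  have [[L Lc]|nc] := pselect (exists L, code L c.1 = c); first by exists L.
  by exists com_one.
exists (range pick).
  by apply: sub_countable (card_image_le _ _) _; exact: countableP.
move=> U [S US] oU; have [n [e e0 nU]] := (com_openP U).1 oU _ US.
have e20 : 0 < e / 2 by rewrite divr_gt0.
have /choice[J_ hJ] i : exists J, pr mu (escapes i (coords S) J) < e / 2.
  exact: escapes_small (measurable_coords S) e20.
pose J := \max_(i < n) J_ i.
have e'0 : 0 < e / 2 / J.+1%:R / 2 by rewrite !divr_gt0.
have [k0 hk0] := exists_invSn_lt e'0.
pose k := maxn k0 (maxn n J).
have hk : k.+1%:R^-1 < e / 2 / J.+1%:R / 2.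
  by apply: le_lt_trans hk0; rewrite lef_pV2 ?posrE// ler_nat ltnS leq_maxl.
have SL : code (pick (code S k)) k = code S k by apply: (pickP (code S k)); exists S.
exists (pick (code S k)); split; last by exists (code S k).
set L := pick _ in SL *; apply: nU => i ni.
pose C j := (piece S i j `+` A (a (S, k, i, j))) `|`
  (piece L i j `+` A (a (L, k, i, j))).
apply: (@pr_cover _ _ _ mu _ (escapes i (coords S) J) C J) => //.
- by apply: measurable_moved; exact: measurable_coords.
- exact: measurable_escapes (measurable_coords S).
- by move=> j; apply: measurableU; exact: measurableY.
- apply: aeW => x SLx.
  have [|/existsNP[j /not_implyP[jJ /contrapT Sj]]] :=
    pselect (escapes i (coords S) J x); first by left.
  right; exists j => //; apply: contrapT => /not_orP[].
  rewrite (codeP _ _ _ _ _ SL); last 2 first.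
  + by rewrite !leq_max ni orbT.
  + by rewrite !leq_max jJ !orbT.
  rewrite !setY_def => /not_orP[nSA nAS] /not_orP[nLA nAL]; apply: SLx.
  rewrite Sj; apply/esym; suff : piece L i j x by [].
  apply: contrapT => Lj; have {}Sj : piece S i j x by [].
  by apply: nAL; split=> //; apply: contrapT => nA; apply: nSA.
- apply: le_trans (ltW (hJ i)); apply: le_pr;
    do ?exact: measurable_escapes (measurable_coords S).
  move=> x h j jJ; apply: h; apply: leq_trans jJ _.
  exact: (leq_bigmax (Ordinal ni)).
- move=> j jJ; apply: le_lt_trans (prU _ _ _) _; do ?exact: measurableY.
  rewrite [ltRHS]splitr ltrD//; apply: lt_trans hk; [exact: (aP (S, k, i, j))|].
  exact: (aP (L, k, i, j)).
Qed.

(** By the continuity of the inverse, the second term does not change the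
    topology; it makes the joined metric complete (compare [symZN_limit]). *)
Definition com_pseudo i S L : R :=
  disagr mu i (coords S) (coords L) +
  disagr mu i (coords (com_inv S)) (coords (com_inv L)).

Definition com_dist : G -> G -> R := join_dist com_pseudo.

Lemma com_pseudoP i : is_pseudometric (com_pseudo i).
Proof.
split.
- by move=> S L; rewrite addr_ge0// disagr_ge0.
- by move=> S; rewrite /com_pseudo !disagrxx addr0.
- by move=> S L; rewrite /com_pseudo disagrC [X in _ + X]disagrC.
- move=> S1 S2 S3; rewrite /com_pseudo addrACA lerD//;
    apply: disagr_triangle; exact: measurable_coords.
Qed.

Lemma com_dist_ball S e : 0 < e -> exists n, exists2 e', 0 < e' &
  com_ball S n e' `<=` [set L | com_dist S L < e].
Proof.
move=> e0; have e40 : 0 < e / 4 by rewrite divr_gt0.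
have e20 : 0 < e / 2 by rewrite divr_gt0.
have [n hn] := join_dist_lt com_pseudoP e20.
have [m [e' e'0 h]] := com_inv_basis S n e40.
have me : 0 < Num.min e' (e / 4) by rewrite lt_min e'0.
exists (maxn n m), (Num.min e' (e / 4)) => // L SL /=.
apply: (@le_lt_trans _ _ (e / 2)); last by lra.
apply: hn => i ni; rewrite /com_pseudo [ltRHS](_ : _ = e / 4 + e / 4); last by lra.
apply: ltrD.
  by apply: com_ball_widen SL i ni; rewrite ?leq_maxl// ge_min lexx orbT.
by apply: (h L) ni; apply: com_ball_widen SL; rewrite ?leq_maxr// ge_min lexx.
Qed.

Lemma com_ball_dist S n e : 0 < e ->
  exists2 e', 0 < e' & [set L | com_dist S L < e'] `<=` com_ball S n e.
Proof.
move=> /(join_dist_small_below com_pseudoP n)[e' e'0 h]; exists e' => // L /h SL i ni.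
by apply: le_lt_trans (SL i ni); rewrite lerDl disagr_ge0.
Qed.

Lemma com_dist_compatible : compatible_metric com_dist.
Proof.
have [p0 p00 pC pT] := join_dist_pseudo com_pseudoP; split.
  split=> // S L; split=> [SL|->//]; apply: coords_inj.
  have SLi i : disagr mu i (coords S) (coords L) = 0.
    apply/eqP; rewrite eq_le disagr_ge0 andbT; apply/ler_addgt0Pl => e e0.
    have [e' e'0 h] := com_ball_dist S i.+1 e0.
    by rewrite addr0 ltW//; apply: (h L) => //=; rewrite SL.
  have : {ae mu, forall x, forall i,
      (coords S x : symZN) @` comm i = (coords L x : symZN) @` comm i}.
    apply: ae_foralln => i; apply: pr_eq0_negligible (SLi i).
    by apply: measurable_moved; exact: measurable_coords.
  by apply: filterS => x; exact: symZN_eq.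
apply/seteqP; split=> U.
  move=> /com_openP oU S /oU[n [e e0 nU]].
  have [e' e'0 h] := com_ball_dist S n e0.
  by exists e' => // L /h/nU.
move=> oU; apply/com_openP => S /oU[e e0 eU].
have [n [e' e'0 h]] := com_dist_ball S e0.
by exists n, e' => // L /h/eU.
Qed.

(** On the conull invariant set [Om] where the permutations stabilize at every
    point of the orbit, the limit [S] sends [x] to the eventual image of [x];
    off [Om] it is the identity. As [Om] is invariant, [S] inherits from the
    sequence that it is a nonsingular Borel bijection. *)
Lemma com_limit (u : nat -> G) :
  {ae mu, forall x, forall i,
    eventually_constant (fun j => (coords (u j) x : symZN) @` comm i) /\
    eventually_constant (fun j => (coords (com_inv (u j)) x : symZN) @` comm i)} ->
  exists L : G, {ae mu, forall x, forall i, exists n, forall j, (n <= j)%N ->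
    (coords (u j) x : symZN) @` comm i = (coords L x : symZN) @` comm i}.
Proof.
move=> uC; pose v j : preAut mu := repr (com_val (u j)).
pose limit_at x (s : symZN) :=
  (forall i, exists n, forall j, (n <= j)%N ->
    (coords (u j) x : symZN) @` comm i = s @` comm i) /\
  (forall m, exists n, forall j, (n <= j)%N ->
    v j (iterz T m x) = iterz T (s m) x).
pose good x := exists s, limit_at x s.
have gP : {ae mu, forall x, free_at T x /\ good x}.
  have : {ae mu, forall x j, acts_on_orbit T (v j) x (coords (u j) x : symZN) /\
      coords (com_inv (u j)) x = (coords (u j) x : symZN)^-1%g :> symZN}.
    apply: ae_foralln => j; move: (coords_acts (u j)) (coords_inv (u j)).
    by apply: filterS2 => x ? ?.
  move: (ae_free aT) uC; apply: filterS3 => x fx uC uP; split=> //.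
  have [i|i|s [si sm]] := @symZN_limit (fun j => coords (u j) x).
  - by have [] := uC i.
  - have [_ [n hn]] := uC i; exists n => j /hn; have [_ ->] := uP j.
    by have [_ ->] := uP n.
  - exists s; split=> // m; have [n hn] := sm m; exists n => j /hn <-.
    by have [-> _] := uP j.
have [N [mN N0 NP]] := gP.
pose Om : set X := \bigcap_(n : int) (iterz T n @^-1` (~` N)).
have mOm : measurable Om.
  rewrite /Om -[X in measurable X]setCK setC_bigcap; apply: measurableC.
  apply: countable_bigcupT_measurable => // n; apply: measurableC.
  rewrite -[X in measurable X]setTI; apply: measurable_iterz => //.
  exact: measurableC.
have OmP x : Om x -> free_at T x /\ good x.
  by move=> Ox; apply: contrapT => h; apply: (Ox 0 I); exact: NP.
have TD := iterzD (preAut_bij T).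
have OmT x n : Om x -> Om (iterz T n x) by move=> Ox m _; rewrite /= -TD; exact: Ox.
have aeOm : {ae mu, forall x, Om x}.
  have : {ae mu, forall x, ~ N x} by exists N; split=> // x /contrapT.
  by move=> /(ae_orbit sX T); apply: filterS => x h n _; exact: h.
have /choice[s sP] x : exists s : symZN, Om x -> limit_at x s.
  have [Ox|Ox] := pselect (Om x); last by exists 1%g.
  by have [_ [s h]] := OmP x Ox; exists s.
pose S x := if `[< Om x >] then iterz T (s x 0) x else x.
have SOm x : Om x -> S x = iterz T (s x 0) x.
  by move=> Ox; rewrite /S ifT//; exact/asboolP.
have SnOm x : ~ Om x -> S x = x by move=> Ox; rewrite /S ifF//; exact/asboolP.
have Sev x : Om x -> exists n, forall j, (n <= j)%N -> v j x = S x.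
  by move=> Ox; have [_ /(_ 0)] := sP x Ox; rewrite SOm.
have Sacts x : Om x -> acts_on_orbit T S x (s x).
  move=> Ox m; have [n hn] := Sev _ (OmT x m Ox).
  have [_ /(_ m)[n' hn']] := sP x Ox.
  by rewrite -(hn _ (leq_maxl n n')) hn'// leq_maxr.
have OmS x : Om x -> Om (S x) by move=> Ox; rewrite SOm//; exact: OmT.
have Sinj : injective S.
  move=> x y; have [Ox|Ox] := pselect (Om x); have [Oy|Oy] := pselect (Om y).
  - have [n hn] := Sev x Ox; have [n' hn'] := Sev y Oy.
    rewrite -(hn _ (leq_maxl n n')) -(hn' _ (leq_maxr n n')).
    exact: (bij_inj (preAut_bij (v _))).
  - by rewrite (SnOm y)// => Sxy; case: Oy; rewrite -Sxy; exact: OmS.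
  - by rewrite (SnOm x)// => Sxy; case: Ox; rewrite Sxy; exact: OmS.
  - by rewrite !SnOm.
have Sbij : bijective S.
  have /choice[g gK] y : exists x, S x = y.
    have [Oy|Oy] := pselect (Om y); last by exists y; exact: SnOm.
    by exists (iterz T ((s y)^-1%g 0) y); rewrite Sacts// symZN_invVK.
  by exists g => // x; apply: Sinj.
have mv j A : measurable A -> measurable (v j @^-1` A).
  by move=> mA; rewrite -[X in measurable X]setTI; exact: preAut_measurable.
have mS : measurable_fun setT S.
  move=> _ B mB; rewrite setTI (_ : S @^-1` B = (B `\` Om) `|`
      (Om `&` \bigcup_n \bigcap_(j >= n) (v j @^-1` B))).
    apply: measurableU; first exact: measurableD.
    apply: measurableI => //; apply: bigcupT_measurable => n.
    by apply: bigcap_measurableType => j _; exact: mv.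
  apply/seteqP; split=> x.
    move=> BSx; have [Ox|Ox] := pselect (Om x); [right|left]; split=> //.
      have [n hn] := Sev x Ox; exists n => // j nj.
      by rewrite /= (hn j nj).
    by move: BSx; rewrite /= SnOm.
  move=> [[Bx Ox]|[Ox [n _ hn]]]; first by rewrite /= SnOm.
  have [n' hn'] := Sev x Ox.
  by rewrite /= -(hn' _ (leq_maxr n n')); apply: (hn (maxn n n')); rewrite /= leq_maxl.
(* Preimages and images of null sets by [S] are, on [Om], covered by those by
   the [v j]. *)
have nS : nonsingular mu S.
  have [N' [mN' N'0 N'P]] := aeOm.
  have nullI (A : set X) : measurable A -> (mu A = 0)%E <-> mu.-negligible A.
    by move=> mA; apply: iff_sym; exact: negligibleP.
  move=> A mA.
  have mSA : measurable (S @^-1` A) by rewrite -[X in measurable X]setTI; exact: mS.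
  rewrite /pushforward; split=> A0.
    apply/nullI => //; apply: (@negligibleS _ _ _ _
        (N' `|` \bigcup_j (bij_inv (v j) @^-1` (S @^-1` A)))).
      move=> y Ay; have [Oy|Oy] := pselect (Om y); last by left; exact: N'P.
      right; pose x := iterz T ((s y)^-1%g 0) y.
      have Sx : S x = y by rewrite Sacts// symZN_invVK.
      have [n /(_ n (leqnn n)) hn] := Sev x (OmT _ _ Oy).
      exists n => //=; rewrite -{1}Sx -hn bij_invK//; last exact: preAut_bij.
      by rewrite Sx.
    apply: negligibleU; first by exists N'; split.
    apply: negligible_bigcup => j; have [_ mVj nVj] := is_aut_inv sX (v j).
    exists (bij_inv (v j) @^-1` (S @^-1` A)); split=> //.
      by rewrite -[X in measurable X]setTI; exact: mVj.
    exact/nVj.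
  apply/nullI => //; apply: (@negligibleS _ _ _ _ (A `|` \bigcup_j (v j @^-1` A))).
    move=> x ASx; have [Ox|Ox] := pselect (Om x); last by left; rewrite -(SnOm x Ox).
    right; have [n /(_ n (leqnn n)) hn] := Sev x Ox.
    by exists n => //=; rewrite hn.
  apply: negligibleU; first by exists A; split.
  apply: negligible_bigcup => j; have [_ _ nvj] := preAutP (v j).
  by exists (v j @^-1` A); split=> //; [exact: mv|exact/nvj].
pose limS : preAut mu := PreAut (asboolT (And3 Sbij mS nS)).
have cL : com_full_group T (Aut_of limS).
  apply/(com_full_group_Aut_of sX aT); apply: filterS aeOm => x Ox.
  by exists (s x); exact: Sacts.
exists (com_of cL).
have : {ae mu, forall x, coords (com_of cL) x = s x :> symZN}.
  apply: (coords_unique (f := limS)) => //.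
  by apply: filterS aeOm => x Ox; exact: Sacts.
move: aeOm; apply: filterS2 => x Ox -> i.
by have [h _] := sP x Ox; exact: h.
Qed.

Lemma com_dist_complete : metric_complete com_dist.
Proof.
move=> u uC; have [p0 p00 pC pT] := join_dist_pseudo com_pseudoP.
have [|||phi phi_ge phiC] := @cauchy_subsequence _ _ _ mu
    (fun k => coords (u k)) (fun k => coords (com_inv (u k))).
- by move=> k; exact: measurable_coords.
- by move=> k; exact: measurable_coords.
- move=> n e /(join_dist_small_below com_pseudoP n)[e' e'0 h].
  by have [N hN] := uC _ e'0; exists N => k l Nk Nl; exact/h/hN.
have [L uL] := @com_limit (fun j => u (phi j)) phiC.
exists L => e e0; have e20 : 0 < e / 2 by rewrite divr_gt0.
have [n [e' e'0 nL]] := com_dist_ball L e20.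
have /choice[N_ hN] i : exists N, forall j, (N <= j)%N ->
    disagr mu i (coords L) (coords (u (phi j))) < e'.
  apply: ae_eventually_small => //.
    by move=> j; apply: measurable_moved; exact: measurable_coords.
  apply: filterS uL => x /(_ i)[N hN]; exists N => j /hN Lj; apply.
  exact/esym.
have [N hN'] := uC _ e20.
pose j := maxn N (\max_(i < n) N_ i).
exists N => k Nk; apply: le_lt_trans (pT _ (u (phi j)) _) _.
rewrite (splitr e) ltrD//.
  by apply: hN' => //; apply: leq_trans (phi_ge j); exact: leq_maxl.
rewrite pC; apply: nL => i ni; apply: hN; apply: leq_trans (leq_maxr _ _).
exact: (leq_bigmax (Ordinal ni)).
Qed.

End ComFullGroup.

Theorem proposition2p20 (R : realType) (disp : measure_display)
    (X : measurableType disp) (mu : probability X R) (T : preAut mu)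
    (d : symZN_metric R) :
  standard_borel R X -> atomless mu -> aperiodic T ->
  exists (mul : ComFullGroup d T -> ComFullGroup d T -> ComFullGroup d T)
         (one : ComFullGroup d T) (inv : ComFullGroup d T -> ComFullGroup d T),
    (forall S1 S2, com_val (mul S1 S2) = (com_val S1 * com_val S2)%g) /\
    polish_group R mul one inv.
Proof.
move=> sX _ aT.
exists (com_mul sX aT), (com_one d sX aT), (com_inv sX aT); split.
  exact: com_mul_val.
split.
- exact: com_mulA.
- exact: com_mul1.
- exact: com_mulV.
- exact: com_mul_continuous.
- exact: com_inv_continuous.
- exact: com_separable.
- exists (com_dist sX aT); first exact: com_dist_compatible.
  exact: com_dist_complete.
Qed.
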